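(* Let $X$ be a Tychonoff space. Then the following conditions are equivalent: (i) $X$ is $\mathrm{I}$-favorable with respect to co-zero sets; (ii) every $C^*$-embedding of $X$ in another Tychonoff space is $\pi$-regular, i.e. whenever $X$ is a $C^*$-embedded subspace of a Tychonoff space $Y$, $X$ is $\pi$-regularly embedded in $Y$; (iii) $X$ is skeletally generated.
   Context: All spaces are Tychonoff, all maps are continuous, and all inverse systems have directed index sets and surjective bonding maps. **I-favorable with respect to co-zero sets.** Let $\Sigma_X$ be the family of all non-empty co-zero sets in $X$. Two players play as follows: at round $n\ge 0$ Player I chooses $A_n\in\Sigma_X$ and Player II replies with $B_n\in\Sigma_X$, $B_n\subset A_n$. Player I wins if $\bigcup_{n\ge 0}B_n$ is dense in $X$; otherwise Player II wins. $X$ is $\mathrm{I}$-favorable with respect to co-zero sets if Player I has a winning strategy, i.e. a function $\sigma:\bigcup\{\Sigma_X^n:n\ge 0\}\to\Sigma_X$ such that for every play in which Player I plays $A_0=\sigma(\varnothing)$ (value at the empty sequence) and $A_{k+1}=\sigma(B_0,\dots,B_k)$ for all $k\ge 0$, and Player II plays $B_k\in\Sigma_X$ with $B_k\subset A_k$ for all $k\geq 0$, the union $\bigcup_{n\ge 0}B_n$ is dense in $X$. **$C^*$-embedded.** $X\subset Y$ is $C^*$-embedded in $Y$ if every bounded continuous real-valued function on $X$ extends to a continuous real-valued function on $Y$. **$\pi$-regularly embedded.** A $\pi$-base for $X$ is a family of open sets of $X$ such that every non-empty open set of $X$ contains a non-empty member of the family. A subspace $X\subset Y$ is $\pi$-regularly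 embedded in $Y$ if there exist a $\pi$-base $\mathcal B$ for $X$ and a function $\mathrm{e}:\mathcal B\to\mathcal T_Y$, where $\mathcal T_Y$ is the topology of $Y$, such that for all $U,V\in\mathcal B$: (1) $\mathrm{e}(U)\cap X$ is a dense subset of $U$; (2) $\mathrm{e}(U)\cap \mathrm{e}(V)=\varnothing$ provided $U\cap V=\varnothing$. **Skeletal map.** A map $f:X\to Y$ is skeletal if for every non-empty open $U\subset X$ the closure $\overline{f(U)}$ in $Y$ has non-empty interior in $Y$. **Skeletally generated.** $X$ is skeletally generated if there exists an inverse system $S=\{X_\alpha,p^\beta_\alpha,A\}$ of separable metric spaces $X_\alpha$ such that: (3) all bonding maps $p^\beta_\alpha$ are surjective and skeletal; (4) the index set $A$ is $\sigma$-complete (every countable chain in $A$ has a supremum in $A$); (5) for every countable chain $\{\alpha_n:n\ge1\}\subset A$ with $\beta=\sup\{\alpha_n:n\ge 1\}$, the space $X_\beta$ is (naturally, via the maps $p^\beta_{\alpha_n}$) a (dense) subspace of $\varprojlim\{X_{\alpha_n},p^{\alpha_{n+1}}_{\alpha_n}\}$; (6) $X$ is embedded in $\varprojlim S$ so that $p_\alpha(X)=X_\alpha$ for each $\alpha$, where $p_\alpha:\varprojlim S\to X_\alpha$ is the $\alpha$-th limit projection; (7) for every bounded continuous function $f:X\to\mathbb R$ there exist $\alpha\in A$ and a continuous function $g:X_\alpha\to\mathbb R$ with $f=g\circ(p_\alpha|X)$. *)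

(* Defs.v *)
From HB Require Import structures.
From mathcomp Require Import all_boot all_order all_algebra.
From mathcomp Require Import all_classical all_reals.
From mathcomp Require Import topology normedtype.

Set Implicit Arguments.
Unset Strict Implicit.
Unset Printing Implicit Defensive.

Import Order.TTheory GRing.Theory Num.Theory.
Import numFieldNormedType.Exports.

Local Open Scope classical_set_scope.
Local Open Scope ring_scope.

Definition tychonoff_space (X : topologicalType) :=
  hausdorff_space X /\ completely_regular_space X.

(** * The game on non-empty co-zero sets *)

Definition cozero (R : realType) (X : topologicalType) (U : set X) :=
  exists2 f : X -> R, continuous f & U = [set x | f x != 0].

(* Sigma_X *)
Definition nonempty_cozero (R : realType) (X : topologicalType) :
  set (set X) := [set U | cozero R U /\ U !=set0].
Arguments nonempty_cozero R X : clear implicits.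

(* [sigma (mkseq B k)] is the move A_k of Player I after the replies
   B_0, ..., B_{k-1} of Player II.  If X is empty then so is Sigma_X, and there
   is no strategy at all. *)
Definition I_winning_strategy (R : realType) (X : topologicalType)
    (sigma : seq (nonempty_cozero R X) -> nonempty_cozero R X) :=
  forall B : nat -> nonempty_cozero R X,
    (forall k, val (B k) `<=` val (sigma (mkseq B k))) ->
    dense (\bigcup_k val (B k)).

Definition I_favorable_cozero (R : realType) (X : topologicalType) :=
  exists sigma : seq (nonempty_cozero R X) -> nonempty_cozero R X,
    I_winning_strategy sigma.

(** * Embeddings.  A subspace X of Y is given by an embedding i : X -> Y, so
   that a trace A `&` X becomes the preimage i @^-1` A. *)

Definition embedding (X Y : topologicalType) (i : X -> Y) :=
  [/\ continuous i, injective i &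
      forall U : set X, open U -> exists2 V : set Y, open V & i @^-1` V = U].

Definition Cstar_embedding (R : realType) (X Y : topologicalType)
    (i : X -> Y) :=
  embedding i /\
  forall f : X -> R, continuous f -> bounded_fun f ->
    exists2 g : Y -> R, continuous g & forall x, g (i x) = f x.

Definition pi_base (X : topologicalType) (B : set (set X)) :=
  B `<=` open /\
  forall O : set X, open O -> O !=set0 ->
    exists V, [/\ B V, V !=set0 & V `<=` O].

(* Only the values of e on B matter. *)
Definition pi_regular (X Y : topologicalType) (i : X -> Y) :=
  exists (B : set (set X)) (e : set X -> set Y),
    [/\ pi_base B,
        forall U, B U -> open (e U),
        forall U, B U -> i @^-1` e U `<=` U /\ U `<=` closure (i @^-1` e U) &
        forall U V, B U -> B V -> U `&` V = set0 -> e U `&` e V = set0].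

Definition every_Cstar_embedding_pi_regular (R : realType)
    (X : topologicalType) :=
  forall (Y : topologicalType) (i : X -> Y),
    tychonoff_space Y -> Cstar_embedding R i -> pi_regular i.

(** * Inverse systems *)

Definition skeletal (X Y : topologicalType) (f : X -> Y) :=
  forall U : set X, open U -> U !=set0 -> (closure (f @` U))° !=set0.

Record inverse_system (d : Order.disp_t) (A : porderType d)
    (T : A -> topologicalType) := InverseSystem {
  bond : forall a b : A, (a <= b)%O -> T b -> T a;
  index_directed : forall a b : A, exists c : A, (a <= c)%O /\ (b <= c)%O;
  bond_continuous : forall a b (ab : (a <= b)%O), continuous (bond ab);
  bond_surjective : forall a b (ab : (a <= b)%O), range (bond ab) = setT;
  bond_refl : forall a (aa : (a <= a)%O) x, bond aa x = x;
  bond_trans : forall a b c (ab : (a <= b)%O) (bc : (b <= c)%O)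
    (ac : (a <= c)%O) x, bond ab (bond bc x) = bond ac x
}.

(* Inverse limits are subspaces of products: the topology of [invlim S] as a
   type is the one induced from [prod_topology]. *)
Definition invlim (d : Order.disp_t) (A : porderType d)
    (T : A -> topologicalType) (S : inverse_system T) : set (prod_topology T) :=
  [set x | forall a b (ab : (a <= b)%O), bond S ab (x b) = x a].

Definition invlim_seq (T : nat -> topologicalType)
    (p : forall n, T n.+1 -> T n) : set (prod_topology T) :=
  [set x | forall n, p n (x n.+1) = x n].

Definition sigma_complete (d : Order.disp_t) (A : porderType d) :=
  forall C : set A, C !=set0 -> countable C ->
    total_on C (fun a b => (a <= b)%O) -> supremums C !=set0.

Definition separable (X : topologicalType) :=
  exists2 D : set X, countable D & dense D.

Definition skeletally_generated (R : realType) (X : topologicalType) :=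
  exists (d : Order.disp_t) (A : porderType d) (T : A -> metricType R)
         (S : inverse_system T),
    [/\ forall a, separable (T a),
        forall a b (ab : (a <= b)%O), skeletal (bond S ab),
        sigma_complete A,
        (* For an increasing sequence with supremum b, T b is a dense subspace
           of the limit of the sequence, via the diagonal k of the bonding
           maps out of T b. *)
        forall (alpha : nat -> A) (b : A)
               (alphaS : forall n, (alpha n <= alpha n.+1)%O)
               (alphab : forall n, (alpha n <= b)%O),
          supremums (range alpha) b ->
          exists k : T b ->
                     invlim_seq (T := T \o alpha) (fun n => bond S (alphaS n)),
            [/\ embedding k, dense (range k) &
                forall x n, val (k x) n = bond S (alphab n) x] &
        exists j : X -> invlim S,
          [/\ embedding j,
              forall a, range (fun x => val (j x) a) = setT &
              forall f : X -> R, continuous f -> bounded_fun f ->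
                exists (a : A) (g : T a -> R),
                  continuous g /\ forall x, f x = g (val (j x) a)]].

(* Main.v *)
Require Import Defs.
From HB Require Import structures.
From mathcomp Require Import all_boot all_order all_algebra.
From mathcomp Require Import all_classical all_reals.
From mathcomp Require Import topology normedtype.
From mathcomp Require Import wochoice lra.

(** Call a family Q of non-empty co-zero sets closed if it is stable under a
    winning strategy sigma of Player I and under non-empty intersections.
    Whatever its size, a closed family sees all of X
    ([closed_family_reflects]): for every non-empty open W it has a member V
    all of whose subsets in Q meet W; otherwise Player II could avoid W without
    ever leaving Q.

    I-favorable spaces have pi-regular C*-embeddings.  Let X be C*-embedded in
    Y.  A regular operator on Q assigns to the members of Q open sets of Y, with
    the right traces, sending disjoint sets to disjoint sets.  For countable Q there is one
    ([countable_regular_operator]): extend functions defining the members of Q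
    to Y with bounds tending to zero, and compare them pointwise.  For
    larger families, let Q be the union of a well-ordered chain of closed
    families Q_a, each with a regular operator e_a.  If a is the first index
    with U in Q_a, let V range over the earlier members such that every earlier
    subset of V meets U, and let e(U) be e_a(U) cut down to the union of the
    sets e(V).  By reflection in the earlier families the trace of e(U) is
    still dense in U, and e(U) is now disjoint from e(V') for every earlier V'
    disjoint from U ([regular_operator_bigcup]).  Transfinite induction over a
    well-order of the co-zero sets then gives an operator on all of them
    ([regular_operator_ex]); at a limit the induction uses gluing, and an
    infinite successor segment is the image of its predecessor, so that the
    induction hypothesis, stated for all reindexings, applies to it.

    Spaces with pi-regular C*-embeddings are skeletally generated.  Evaluation
    embeds X as a C*-embedded subset of the power R^I, where I is the set of bounded continuous functions on X, so there
    is a pi-base B with an operator e.  For a countable a in I let X_a be the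
    metrizable quotient of X by the functions in a.  Suppose that every
    basic box on coordinates in a that meets X contains some U in B for which
    e(U) contains a box on coordinates in a that meets X.  Then X -> X_a is
    skeletal ([pi_regular_box_reflecting]): a box on coordinates in a and a box
    on coordinates outside a always intersect, whence disjointness of e(U) and
    e(W) can be tested on the coordinates in a.  Such sets a are cofinal among
    the countable subsets of I and stable under countable chains, and the
    quotients X_a form the required inverse system ([pi_regular_generated]).

    Skeletally generated spaces are I-favorable.  Every co-zero set is pulled
    back from a stage of the system.
    Player I follows an increasing sequence of stages from which the answers of
    Player II come, and plays by bookkeeping all members of countable pi-bases
    of these stages.  Since the stage at the supremum embeds densely in the
    limit of the sequence, these members form a pi-base of it, and the union of
    the answers is dense there; since the projection of X to it is skeletal, the
    union is dense in X
    ([generated_favorable]). *)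

Set Implicit Arguments.
Unset Strict Implicit.
Unset Printing Implicit Defensive.

Import Order.TTheory GRing.Theory Num.Theory.
Import numFieldNormedType.Exports.

Local Open Scope classical_set_scope.
Local Open Scope ring_scope.

(** * Co-zero sets *)

Lemma cozero_open (R : realType) (X : topologicalType) (U : set X) :
  cozero R U -> open U.
Proof.
move=> [f cf ->]; have -> : [set x | f x != 0] = f @^-1` (~` [set 0]).
  by apply/seteqP; split => x /= /eqP.
apply: open_comp => [x _|]; first exact: cf.
exact/closed_openC/closed_eq.
Qed.

Lemma open_lt_continuous (R : realType) (T : topologicalType) (f g : T -> R) :
  continuous f -> continuous g -> open [set x | f x < g x].
Proof.
move=> cf cg; have -> : [set x | f x < g x] =
    (fun x => g x - f x) @^-1` [set r | 0 < r].
  by apply/seteqP; split=> x /=; rewrite subr_gt0.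
apply: (open_comp _ (@open_gt R _)) => x _.
by apply: cvgB; [exact: cg|exact: cf].
Qed.

Lemma bounded_fun0 (R : realType) (X : Type) : bounded_fun (fun _ : X => 0 : R).
Proof. by exists 0; split; [exact: num_real|move=> M M0 x _ /=; rewrite normr0 ltW]. Qed.

Lemma exists_invS_lt (R : realType) (e : R) : 0 < e -> exists n, n.+1%:R^-1 < e.
Proof.
by move=> e0; exists (Num.truncn e^-1); rewrite invf_plt ?posrE// truncnS_gt.
Qed.

Lemma countable_setU (T : Type) (A B : set T) :
  countable A -> countable B -> countable (A `|` B).
Proof. by move=> cA cB; rewrite -bigcup2E; apply: bigcup_countable => // -[|[|n]]. Qed.

Lemma cozeroI (R : realType) (X : topologicalType) (U V : set X) :
  cozero R U -> cozero R V -> cozero R (U `&` V).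
Proof.
move=> [f cf ->] [g cg ->]; exists (f \* g).
  by move=> x; apply: continuousM; [exact: cf|exact: cg].
by apply/seteqP; split => x /=; rewrite mulf_eq0 negb_or => /andP.
Qed.

(** Boundedness is what makes the function extend along C*-embeddings and
    factor through the stages of a skeletally generated space. *)
Lemma cozero_capped (R : realType) (X : topologicalType) (U : set X) (c : R) :
  cozero R U -> 0 < c -> exists h : X -> R,
    [/\ continuous h, bounded_fun h, forall x, 0 <= h x, forall x, h x <= c &
        U = [set x | 0 < h x]].
Proof.
move=> [f cf Uf] c0; pose h x := Num.min `|f x| c.
have h0 x : 0 <= h x by rewrite le_min normr_ge0 ltW.
have hc x : h x <= c by rewrite /h ge_min lexx orbT.
exists h; split=> //.
- move=> x; apply: (@continuous_min _ _ (fun y => `|f y|) (fun=> c)); last exact: cvg_cst.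
  by apply: continuous_comp; [exact: cf|exact: norm_continuous].
- exists c; split; first exact: num_real.
  by move=> M cM x _ /=; rewrite ger0_norm//; apply: le_trans (ltW cM).
- by rewrite Uf; apply/seteqP; split=> x /=; rewrite /h lt_min c0 andbT normr_gt0.
Qed.

Lemma completely_regular_bump (R : realType) (X : topologicalType) :
  completely_regular_space X -> forall x (O : set X), open O -> O x ->
  exists f : X -> R, [/\ continuous f, bounded_fun f, f x = 0 &
    forall y, f y != 1 -> O y].
Proof.
move=> crX x O oO Ox.
have [|f [cf f01 f0 f1]] := (uniform_separatorP (R := R) [set x] (~` O)).1.
  by apply: crX; [exact: open_closedC|exact].
exists f; split=> //.
- exists 1; split; first exact: num_real.
  move=> M M1 y _ /=; have : `[0, 1]%classic (f y) by apply: f01; exists y.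
  rewrite /= in_itv /= => /andP[fy0 fy1].
  by rewrite ger0_norm// (le_trans fy1)// ltW.
- by apply: f0; exists x.
- by move=> y /eqP fy1; apply: contrapT => nOy; apply: fy1; apply: f1; exists y.
Qed.

Lemma cozero_pi_base (R : realType) (X : topologicalType) :
  completely_regular_space X -> pi_base (nonempty_cozero R X).
Proof.
move=> crX; split=> [U [/cozero_open]//|O oO [x Ox]].
have [f [cf _ fx fO]] := completely_regular_bump R crX oO Ox.
have f1x : 1 - f x != 0 by rewrite fx subr0 oner_neq0.
exists [set y | 1 - f y != 0]; split.
- split; last by exists x.
  by exists (fun y => 1 - f y) => // y; apply: cvgB; [exact: cvg_cst|exact: cf].
- by exists x.
- by move=> y /= fy; apply: fO; rewrite eq_sym -subr_eq0.
Qed.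

(** * Well-orders and infinite sets *)

Section well_order.
Context (T : eqType) (wo : rel T).
Hypothesis woT : well_order wo.

Lemma wo_least (A : set T) : A !=set0 ->
  exists2 x, A x & forall y, A y -> wo x y.
Proof.
move=> [x Ax]; have [|z [[zA zmin] _]] := @woT [pred x | `[< A x >]].
  by exists x; apply/asboolP.
exists z; first exact/asboolP.
by move=> y Ay; apply: zmin; apply/asboolP.
Qed.

Lemma wo_ind (P : T -> Prop) :
  (forall x, (forall y, ~~ wo x y -> P y) -> P x) -> forall x, P x.
Proof.
move=> IH x; apply: contrapT => nPx.
have [|z nPz zmin] := @wo_least [set z | ~ P z]; first by exists x.
apply: nPz; apply: IH => y zy; apply: contrapT => /zmin; exact/negP.
Qed.

Lemma wo_total : total wo.
Proof.
move=> x y; have [|z] := @wo_least [set x; y]; first by exists x; left.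
by move=> [] -> h; rewrite h ?orbT//; [right|left].
Qed.

Lemma wo_anti x y : wo x y -> wo y x -> x = y.
Proof.
move=> xy yx; have refl u : wo u u by have := wo_total u u; rewrite orbb.
have [|z [_ zuniq]] := @woT [pred u | (u == x) || (u == y)].
  by exists x; rewrite inE eqxx.
rewrite -(zuniq x) ?(zuniq y)//; split; rewrite ?inE ?eqxx ?orbT//.
  by move=> u; rewrite inE => /orP[] /eqP->.
by move=> u; rewrite inE => /orP[] /eqP->.
Qed.

Lemma wo_trans : transitive wo.
Proof.
move=> y x z xy yz.
have [|t tA tmin] := @wo_least [set x; y; z]; first by exists x; left; left.
move: tA => [[]|] /= tE; subst t.
- by apply: tmin; right.
- by rewrite (wo_anti xy)//; apply: tmin; left; left.
- by rewrite -(wo_anti yz)//; apply: tmin; left; right.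
Qed.

Lemma wo_lt_le x y : ~~ wo y x -> wo x y.
Proof. by move=> yx; have := wo_total x y; rewrite (negbTE yx) orbF. Qed.

End well_order.

(** Hilbert's hotel: the new point takes the place of the first term of a
    sequence of distinct points of A, which moves one step along. *)
Lemma infinite_surj_setU1 (T : Type) (A : set T) (m : T) : infinite_set A ->
  exists h : T -> T, h @` A = m |` A.
Proof.
move=> /infiniteP/card_leP[F]; pose f n := val (F (to_setT n)).
have fA n : A (f n) by exact: set_valP.
have finj n k : f n = f k -> n = k.
  move=> /val_inj Fnk; have := @inj _ _ _ F _ _ (in_setT _) (in_setT _) Fnk.
  by move=> /(congr1 val).
pose h a := if pselect (exists n, f n = a) is left ex
  then (if projT1 (cid ex) is n.+1 then f n else m) else a.
have hf n : h (f n) = if n is n'.+1 then f n' else m.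
  rewrite /h; case: pselect => [ex|[]]; last by exists n.
  by case: cid => k /= /finj->.
exists h; apply/seteqP; split=> [_ [a Aa <-]|a [->|Aa]].
- rewrite /h; case: pselect => [ex|_]; last by right.
  by case: cid => -[|n] /= _; [left|right; exact: fA].
- by exists (f 0%N); [exact: fA|rewrite hf].
- have [[n <-]|nfa] := pselect (exists n, f n = a).
    by exists (f n.+1); rewrite ?hf//; exact: fA.
  by exists a => //; rewrite /h; case: pselect.
Qed.

(** * Families of co-zero sets closed under a strategy *)

Section closed_families.
Context (R : realType) (X : topologicalType).
Local Notation Sig := (nonempty_cozero R X).
Context (sigma : seq Sig -> Sig).
Implicit Types (U V W : Sig) (Q D : set Sig).

Lemma nonempty_cozero_open U : open (val U).
Proof. by apply: (@cozero_open R); have [] := set_valP U. Qed.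

Lemma nonempty_cozero_neq0 U : val U !=set0.
Proof. by have [] := set_valP U. Qed.

(** The value on a pair of disjoint sets is junk, namely the first set. *)
Definition meet U V : Sig := insubd U (val U `&` val V).

Lemma val_meet U V : val U `&` val V !=set0 -> val (meet U V) = val U `&` val V.
Proof.
move=> UV; rewrite /meet val_insubd mem_set//; split=> //.
by apply: cozeroI; [have [] := set_valP U|have [] := set_valP V].
Qed.

(** Stability under [sigma] keeps a play inside the family as long as Player II
    answers there; stability under [meet] lets disjointness be tested by the
    members of the family. *)
Definition closed_family Q :=
  (forall s : seq Sig, (forall U, U \in s -> Q U) -> Q (sigma s)) /\
  (forall U V, Q U -> Q V -> Q (meet U V)).

Definition hull D : set Sig :=
  [set U | forall Q, closed_family Q -> D `<=` Q -> Q U].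

Lemma hull_closed D : closed_family (hull D).
Proof.
split=> [s sD Q Qcl DQ|U V UD VD Q Qcl DQ].
  by apply: Qcl.1 => U /sD; exact.
by apply: Qcl.2; [exact: UD|exact: VD].
Qed.

Lemma sub_hull D : D `<=` hull D.
Proof. by move=> U DU Q _; exact. Qed.

Lemma hull_min D Q : closed_family Q -> D `<=` Q -> hull D `<=` Q.
Proof. by move=> Qcl DQ U; exact. Qed.

Lemma hullS D D' : D `<=` D' -> hull D `<=` hull D'.
Proof.
by move=> DD'; apply: hull_min; [exact: hull_closed|move=> U /DD'; exact: sub_hull].
Qed.

(** The members of the hull are the values of terms in the two operations, and
    terms with variables indexed by nat are coded by a countable type of
    trees. *)
Lemma countable_hull D : countable D -> countable (hull D).
Proof.
move=> /pfcard_geP D0.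
have [d Dd] : exists d : nat -> Sig, D `<=` range d.
  case: D0 => [->|[d]]; first by exists (fun=> sigma [::]).
  by exists d => U /'surj_d[n _ <-]; exists n.
pose fix eval (t : GenTree.tree nat) : Sig := match t with
  | GenTree.Leaf n => d n
  | GenTree.Node 0 ts => sigma (map eval ts)
  | GenTree.Node _ ts => if map eval ts is [:: U; V] then meet U V
                         else sigma [::]
  end.
apply: (@sub_countable _ _ _ (range eval)); last first.
  exact: sub_countable (card_image_le _ _) (countableP _).
apply: subset_card_le; apply: hull_min; last first.
  by move=> U /Dd[n _ <-]; exists (GenTree.Leaf n).
split=> [s sE|U V [t _ <-] [u _ <-]]; last by exists (GenTree.Node 1 [:: t; u]).
suff [ts <-] : exists ts, map eval ts = s by exists (GenTree.Node 0 ts).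
elim: s sE => [_|U s IHs sE]; first by exists [::].
have [|ts <-] := IHs; first by move=> V sV; apply: sE; rewrite inE sV orbT.
by have [|t _ <-] := sE U; [rewrite mem_head|exists (t :: ts)].
Qed.

(** Both operations are finitary. *)
Lemma closed_bigcup (T : eqType) (le : rel T) (C : set T) (Q : T -> set Sig) :
  C !=set0 -> total le ->
  (forall a b, C a -> C b -> le a b -> Q a `<=` Q b) ->
  (forall a, C a -> closed_family (Q a)) ->
  closed_family (\bigcup_(a in C) Q a).
Proof.
move=> [c Cc] letot Qmono Qcl.
have Qdir a b : C a -> C b -> exists2 c, C c & Q a `<=` Q c /\ Q b `<=` Q c.
  move=> Ca Cb; have /orP[ab|ba] := letot a b.
    by exists b => //; split=> //; exact: Qmono.
  by exists a => //; split=> //; exact: Qmono.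
split=> [s sQ|U V [a Ca aU] [b Cb bV]]; last first.
  have [e Ce [ae be]] := Qdir a b Ca Cb.
  by exists e => //; apply: (Qcl e Ce).2; [exact: ae|exact: be].
suff [a Ca sa] : exists2 a, C a & forall U, U \in s -> Q a U.
  by exists a => //; exact: (Qcl a Ca).1.
elim: s sQ => [_|U s IHs sQ]; first by exists c.
have [|a Ca sa] := IHs; first by move=> V sV; apply: sQ; rewrite inE sV orbT.
have [|b Cb bU] := sQ U; first by rewrite mem_head.
have [e Ce [ae be]] := Qdir a b Ca Cb; exists e => // V.
by rewrite inE => /orP[/eqP->|/sa /ae//]; exact: be.
Qed.

(** If every V in Q had a subset in Q missing W, Player II could always answer
    with such a subset: all moves would stay in Q and the union of the answers
    would miss W, against the choice of [sigma]. *)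
Lemma closed_family_reflects Q (W : set X) : I_winning_strategy sigma ->
  closed_family Q -> open W -> W !=set0 ->
  exists2 V, Q V & forall V', Q V' -> val V' `<=` val V -> val V' `&` W !=set0.
Proof.
move=> win Qcl oW W0; apply: contrapT => noV.
have step V : exists V', Q V -> [/\ Q V', val V' `<=` val V & val V' `&` W = set0].
  have [QV|//] := pselect (Q V); last by exists V.
  apply: contrapT => noV'; apply: noV; exists V => // V' QV' V'V.
  by apply/set0P/eqP => V'W; apply: noV'; exists V'.
have [h hP] := choice step.
(* The list of the first n answers of Player II in this play. *)
pose fix hist n : seq Sig :=
  if n is n'.+1 then rcons (hist n') (h (sigma (hist n'))) else [::].
pose B n := h (sigma (hist n)).
have histE n : mkseq B n = hist n by elim: n => //= n IHn; rewrite mkseqS IHn.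
have histQ n U : U \in hist n -> Q U.
  elim: n U => //= n IHn U; rewrite mem_rcons inE => /orP[/eqP->|/IHn//].
  by have [] := hP _ (Qcl.1 _ IHn).
have moveQ n : Q (sigma (hist n)) by apply: Qcl.1; exact: histQ.
have [|x [Wx [n _ Bx]]] := win B _ W W0 oW.
  by move=> n; rewrite histE; have [] := hP _ (moveQ n).
have [_ _] := hP _ (moveQ n); by rewrite -subset0 => /(_ x); apply.
Qed.

End closed_families.

(** * Regular operators *)

Lemma open_bigcap_nat (T : topologicalType) (F : nat -> set T) n :
  (forall m, open (F m)) -> open (\bigcap_(m in `I_n) F m).
Proof.
move=> Fo; elim: n => [|n IHn]; first by rewrite II0 bigcap_set0; exact: openT.
by rewrite IIS bigcap_setU bigcap_set1; exact: openI.
Qed.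

Section operators.
Context (R : realType) (X Y : topologicalType) (i : X -> Y).
Local Notation Sig := (nonempty_cozero R X).
Implicit Types (U V W : Sig) (Q D : set Sig).

(** The requirements of pi-regularity, for the sets in Q only. *)
Definition regular_operator Q (e : Sig -> set Y) :=
  [/\ forall U, Q U -> open (e U),
      forall U, Q U -> i @^-1` e U `<=` val U,
      forall U, Q U -> val U `<=` closure (i @^-1` e U) &
      forall U V, Q U -> Q V -> val U `&` val V = set0 -> e U `&` e V = set0].

Lemma regular_operatorS Q Q' e :
  Q `<=` Q' -> regular_operator Q' e -> regular_operator Q e.
Proof.
move=> QQ' [eo et ed ei]; split=> [U /QQ'|U /QQ'|U /QQ'|U V /QQ' U' /QQ']; auto.
Qed.

Lemma Cstar_cozero_extension U (c : R) : Cstar_embedding R i -> 0 < c ->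
  exists g : Y -> R, [/\ continuous g, forall y, g y <= c,
    val U = [set x | 0 < g (i x)] & forall x, 0 <= g (i x)].
Proof.
move=> [_ iC] c0; have [cU _] := set_valP U.
have [h [ch hb h0 hc Uh]] := cozero_capped cU c0.
have [g cg gh] := iC h ch hb.
have gE x : Num.min (g (i x)) c = h x by rewrite gh min_l.
exists (fun y => Num.min (g y) c); split.
- by move=> y; apply: continuous_min; [exact: cg|exact: cvg_cst].
- by move=> y; rewrite ge_min lexx orbT.
- by rewrite Uh; apply/seteqP; split=> x /=; rewrite gE.
- by move=> x; rewrite gE.
Qed.

(** Let g n be an extension to Y of a function defining the n-th set, with
    0 <= g n <= 1/(n+1) on X and g n <= 1/(n+1) on Y.  Put in E n the points
    where g n > 0 and g n > g m for all m such that the m-th and n-th sets are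
    disjoint.  So E n and E m cannot meet for such m and n.  Where g n > 1/(k+1), only
    the indices m <= k matter, so finitely many strict inequalities suffice near
    each point and E n is open. *)
Lemma countable_regular_operator Q : Cstar_embedding R i -> countable Q ->
  exists e, regular_operator Q e.
Proof.
move=> iC /pfcard_geP Q0.
have [[d]|nosig] := pselect ($| {surjfun [set: nat] >-> Q} |); last first.
  case: Q0 => // ->; exists (fun=> set0); split=> // U V [].
have n0 n : 0 < n.+1%:R^-1 :> R by rewrite invr_gt0 ltr0n.
have /choice[g gP] n := Cstar_cozero_extension (d n) iC (n0 n).
have cg n : continuous (g n) by have [] := gP n.
have gc n y : g n y <= n.+1%:R^-1 by have [] := gP n.
have gU n : val (d n) = [set x | 0 < g n (i x)] by have [] := gP n.
pose disj m n := val (d m) `&` val (d n) = set0.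
pose E n := \bigcup_k ([set y | k.+1%:R^-1 < g n y] `&`
  \bigcap_(m in `I_k.+1) [set y | disj m n -> g m y < g n y]).
have Elt n y m : E n y -> disj m n -> g m y < g n y.
  move=> [k _ [/= kn km]] mn; have [mk|km'] := leqP m k; first exact: km.
  apply: le_lt_trans kn; apply: le_trans (gc m y) _.
  by rewrite lef_pV2 ?posrE ?ltr0n// ler_nat ltnW.
have Eop n : open (E n).
  apply: bigcup_open => k _; apply: openI.
    by apply: open_lt_continuous => //; exact: cst_continuous.
  apply: open_bigcap_nat => m; have [mn|nmn] := pselect (disj m n); last first.
    have -> : [set y | disj m n -> g m y < g n y] = setT; last exact: openT.
    by apply/seteqP; split=> // y _ /= /nmn.
  have -> : [set y | disj m n -> g m y < g n y] = [set y | g m y < g n y].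
    by apply/seteqP; split=> y //=; exact.
  exact: open_lt_continuous.
have EU n : i @^-1` E n = val (d n).
  rewrite gU; apply/seteqP; split=> x /=.
    by move=> [k _ [/= kn _]]; apply: le_lt_trans kn; rewrite ltW.
  move=> gx; have [k kn] := exists_invS_lt gx.
  exists k => //; split=> //= m _ mn.
  have [_ _ Um gm0] := gP m; rewrite (le_lt_trans _ gx)// leNgt; apply/negP => gm.
  have : (val (d m) `&` val (d n)) x by rewrite Um gU; split.
  by rewrite mn.
exists (fun U => \bigcup_(n in [set n | d n = U]) E n); split=> [U _|U _|U QU|U V _ _ UV].
- by apply: bigcup_open => n _; exact: Eop.
- by move=> x [n /= <- Enx]; rewrite -EU.
- have [n _ dn] := 'surj_d QU; apply: subset_trans (@subset_closure _ _).
  by move=> x; rewrite -dn -EU => Ex; exists n.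
- rewrite -subset0 => y [[n /= dn En] [m /= dm Em]].
  have := Elt n y m En; rewrite /disj setIC dn dm => /(_ UV) h.
  by have := lt_trans h (Elt m y n Em _); rewrite /disj dn dm ltxx => /(_ UV).
Qed.

(** ** Gluing operators along a well-ordered chain *)

Section gluing.
Context (sigma : seq Sig -> Sig) (sigma_win : I_winning_strategy sigma).
Context (T : eqType) (wo : rel T) (woT : well_order wo).
Context (A : set T) (Q : T -> set Sig) (e : T -> Sig -> set Y).
Hypotheses (i_cont : continuous i)
  (Qmono : forall a b, A a -> A b -> wo a b -> Q a `<=` Q b)
  (Qclosed : forall a, A a -> closed_family sigma (Q a))
  (eP : forall a, A a -> regular_operator (Q a) (e a)).

(** The part of the chain before stage a. *)
Let older a := \bigcup_(b in [set b | A b /\ ~~ wo a b]) Q b.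

(** The first stage at which U appears. *)
Let rank U a := [/\ A a, Q a U & forall b, A b -> Q b U -> wo a b].

(** The recursion e(U) = e_a(U) `&` (union of the e(V)) on the rank a of U, as an
    inductive predicate on points; the sets V are the older sets none of whose
    older subsets miss U.  At the least stage there is nothing older to comply
    with. *)
Inductive glued U : set Y :=
| Glued_first a y : rank U a -> (forall V, ~ older a V) -> e a U y -> glued U y
| Glued_later a V y : rank U a -> older a V ->
    (forall V', older a V' -> val V' `<=` val V -> val V' `&` val U !=set0) ->
    glued V y -> e a U y -> glued U y.

Let rank_ex U : (\bigcup_(a in A) Q a) U -> exists a, rank U a.
Proof.
move=> [a Aa aU]; have [|b [Ab bU] bmin] := @wo_least _ _ woT [set b | A b /\ Q b U].
  by exists a.
by exists b; split=> // c Ac cU; exact: bmin (conj Ac cU).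
Qed.

Let rank_older U a : rank U a -> forall V, older a V ->
  exists2 b, rank V b & ~~ wo a b.
Proof.
move=> _ V [b [Ab ba] bV]; have [|c [Ac cV cmin]] := @rank_ex V; first by exists b.
by exists c => //; apply: contra ba => ac; apply: wo_trans woT _ _ _ ac _; exact: cmin.
Qed.

Let older_closed a V : older a V -> closed_family sigma (older a).
Proof.
move=> [b bA _]; apply: (closed_bigcup (le := wo)); first by exists b.
- exact: wo_total.
- by move=> c d [Ac _] [Ad _]; exact: Qmono.
- by move=> c [Ac _]; exact: Qclosed.
Qed.

Let rank_uniq U a b : rank U a -> rank U b -> a = b.
Proof.
move=> [Aa aU amin] [Ab bU bmin].
by apply: wo_anti woT _ _ _ _; [exact: amin|exact: bmin].
Qed.

Let glued_sub U a : rank U a -> glued U `<=` e a U.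
Proof.
move=> rUa y Uy; case: Uy rUa => {y}[b y rUb _ bUy|b V y rUb _ _ _ bUy] rUa;
  by rewrite (rank_uniq rUa rUb).
Qed.

Let glued_older U a V0 y : rank U a -> older a V0 -> glued U y ->
  exists V, [/\ older a V, glued V y & forall V', older a V' ->
    val V' `<=` val V -> val V' `&` val U !=set0].
Proof.
move=> rUa aV0 Uy; case: Uy rUa aV0 => {y}[b y rUb noV _|b V y rUb bV VU Vy _] rUa.
  by rewrite (rank_uniq rUa rUb) => /noV.
by rewrite (rank_uniq rUa rUb) => _; exists V.
Qed.

Lemma glued_open U : open (glued U).
Proof.
rewrite openE => y; rewrite /interior.
elim=> {U y}[U a y rUa noV aUy|U a V y rUa aV VU _ IH aUy].
  have [Aa aU _] := rUa; have [eo _ _ _] := eP Aa.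
  by apply: filterS (open_nbhs_nbhs (conj (eo U aU) aUy)) => z; exact: Glued_first.
have [Aa aU _] := rUa; have [eo _ _ _] := eP Aa.
apply: filterS (filterI IH (open_nbhs_nbhs (conj (eo U aU) aUy))) => z [].
exact: Glued_later rUa aV VU.
Qed.

(** An open W inside U is reflected by an older V.  The trace of e(V) is dense
    in V by induction, hence meets W, and there the trace of e_a(U) is
    dense. *)
Lemma glued_dense a : forall U, rank U a -> val U `<=` closure (i @^-1` glued U).
Proof.
elim/(wo_ind woT): a => a IH U rUa; have [Aa aU _] := rUa.
have [eo _ ed _] := eP Aa.
have [[V0 aV0]|noV] := pselect (exists V, older a V); last first.
  move=> x Ux; apply: closureS (ed U aU x Ux) => y /= ay.
  by apply: Glued_first rUa _ ay => V aV; apply: noV; exists V.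
move=> x Ux B xB; pose W := B° `&` val U.
have oW : open W by apply: openI; [exact: open_interior|exact: nonempty_cozero_open].
have W0 : W !=set0 by exists x; split=> //; exact: nbhs_singleton (nbhs_interior xB).
have [V aV VW] := closed_family_reflects sigma_win (older_closed aV0) oW W0.
have [z [Vz Wz]] := VW V aV (@subset_refl _ _).
have [b rVb ba] := rank_older rUa aV.
have [t [/= Vt Wt]] := IH b ba V rVb z Vz W (open_nbhs_nbhs (conj oW Wz)).
have oVW : open (i @^-1` glued V `&` W).
  apply: openI => //; apply: open_comp => [? _|]; first exact: i_cont.
  exact: glued_open.
have [|u [/= au [Vu Wu]]] := ed U aU t _ _ (open_nbhs_nbhs (conj oVW (conj Vt Wt))).
  by case: Wt.
exists u; split; last by apply: interior_subset; case: Wu.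
apply: Glued_later rUa aV _ Vu au => V' aV' V'V.
by have [v [V'v [_ Uv]]] := VW V' aV' V'V; exists v.
Qed.

(** If V is older than U and disjoint from it, and e(V1) is one of the sets whose
    union cuts down e(U), then V1 and V are disjoint: their intersection would be
    an older subset of V1 missing U.  So e(V1) and e(V) are disjoint by
    induction. *)
Lemma glued_disjoint a : forall U V b, rank U a -> rank V b -> wo b a ->
  val U `&` val V = set0 -> glued U `&` glued V = set0.
Proof.
elim/(wo_ind woT): a => a IH U V b rUa rVb ba UV.
rewrite -subset0 => y [Uy Vy].
have [ab|ab] := boolP (wo a b).
  have [Aa aU _] := rUa; have [_ _ _ ei] := eP Aa.
  rewrite -(wo_anti woT ab ba) in rVb; have [_ aV _] := rVb.
  by rewrite -(ei U V aU aV UV); split; [exact: glued_sub rUa _ Uy|exact: glued_sub rVb _ Vy].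
have [Ab bV _] := rVb.
have aV : older a V by exists b.
have [V1 [aV1 V1y V1U]] := glued_older rUa aV Uy.
have V1V : val V1 `&` val V = set0.
  rewrite -subset0 => x V1Vx.
  have VE : val (meet V1 V) = val V1 `&` val V by apply: val_meet; exists x.
  have [||z] := V1U (meet V1 V).
  - by apply: (older_closed aV).2.
  - by rewrite VE; apply: subIsetl.
  - rewrite VE => -[[_ Vz] Uz]; suff : set0 z by []; by rewrite -UV.
have [b1 rV1 ab1] := rank_older rUa aV1.
have /orP[bb1|b1b] := wo_total woT b b1.
  by have := IH b1 ab1 V1 V b rV1 rVb bb1 V1V; rewrite -subset0 => /(_ y); apply.
rewrite setIC in V1V; have := IH b ab V V1 b1 rVb rV1 b1b V1V.
by rewrite -subset0 => /(_ y); apply.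
Qed.

Lemma regular_operator_bigcup : regular_operator (\bigcup_(a in A) Q a) glued.
Proof.
split=> [U _|U /rank_ex[a rUa]|U /rank_ex[a rUa]|U V /rank_ex[a rUa] /rank_ex[b rVb] UV].
- exact: glued_open.
- have [Aa aU _] := rUa; have [_ et _ _] := eP Aa.
  by move=> x /(glued_sub rUa); exact: et.
- exact: glued_dense rUa.
- have /orP[ab|ba] := wo_total woT a b; last exact: glued_disjoint rUa rVb ba UV.
  by rewrite setIC; apply: glued_disjoint rVb rUa ab _; rewrite setIC.
Qed.

End gluing.

(** ** Transfinite induction *)

Section transfinite.
Context (sigma : seq Sig -> Sig) (sigma_win : I_winning_strategy sigma).
Hypothesis iC : Cstar_embedding R i.
Context (wo : rel Sig) (woS : well_order wo).

Let has_operator D := exists e, regular_operator (hull sigma D) e.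

Let countable_case D : countable D -> has_operator D.
Proof. by move=> cD; apply: countable_regular_operator => //; exact: countable_hull. Qed.

Let seg a : set Sig := [set b | ~~ wo a b].

(** The quantification over g is what makes the induction pass an infinite
    successor: an initial segment A with a last element m and infinitely many
    other elements is the image under some h of [seg m], so that [g @` A] is
    the image of [seg m] under [g \o h].  Without last element, A is the union
    of its initial segments and the operators given by the induction hypothesis
    are glued. *)
Let initial_case (A : set Sig) :
  (forall a, A a -> forall g : Sig -> Sig, has_operator (g @` seg a)) ->
  (forall a, A a -> seg a `<=` A) ->
  forall g : Sig -> Sig, has_operator (g @` A).
Proof.
move=> IH down g.
have [cA|ncA] := pselect (countable A).
  by apply: countable_case; exact: sub_countable (card_image_le _ _) cA.
have [[m Am mmax]|nomax] := pselect (exists2 m, A m & forall a, A a -> wo a m).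
  have AE : A `<=` m |` seg m.
    move=> a Aa; have [ma|] := boolP (wo m a); last by right.
    by left; apply: (wo_anti woS) ma; exact: mmax.
  have segm : infinite_set (seg m).
    move=> fm; apply: ncA; apply: sub_countable (subset_card_le AE) _.
    apply: finite_set_countable.
    by rewrite finite_setU; split=> //; exact: finite_set1.
  have [h hA] := infinite_surj_setU1 m segm.
  have -> : A = h @` seg m.
    by rewrite hA; apply/seteqP; split=> // a [->//|]; exact: down.
  by rewrite image_comp; exact: IH.
have A0 : A !=set0.
  by apply/set0P/eqP => A0; apply: ncA; rewrite A0.
have segS a b : wo a b -> seg a `<=` seg b.
  move=> ab c /= ac; apply: contra ac => bc; exact: wo_trans woS _ _ _ ab bc.
pose Q a := hull sigma (g @` seg a).
have Qmono a b : A a -> A b -> wo a b -> Q a `<=` Q b.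
  by move=> _ _ ab; apply: hullS; apply: image_subset; exact: segS.
have Qcl a : A a -> closed_family sigma (Q a) by move=> _; exact: hull_closed.
have /choice[e eP] : forall a, exists e, A a -> regular_operator (Q a) e.
  move=> a; have [Aa|nAa] := pselect (A a); last by exists (fun=> set0).
  by have [e eP] := IH a Aa g; exists e.
have [[ci _ _] _] := iC.
have := regular_operator_bigcup sigma_win woS ci Qmono Qcl eP.
set E := glued _ _ _ _ => EP; exists E; apply: regular_operatorS EP.
apply: hull_min; first exact: closed_bigcup A0 (wo_total woS) Qmono Qcl.
move=> _ [a Aa <-]; have [b Ab ab] : exists2 b, A b & ~~ wo b a.
  apply: contrapT => nob; apply: nomax; exists a => // b Ab.
  by apply/negPn/negP => ba; apply: nob; exists b.
by exists b => //; apply: sub_hull; exists a.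
Qed.

Lemma regular_operator_ex : exists e, regular_operator setT e.
Proof.
have P a : forall g : Sig -> Sig, has_operator (g @` seg a).
  elim/(wo_ind woS): a => a IH; apply: initial_case => [b ba|b ba c cb].
    exact: IH.
  by apply: contra ba => ac; apply: (wo_trans woS ac); exact: wo_lt_le.
have [//|//|e eP] := @initial_case setT _ _ id.
by exists e; apply: regular_operatorS eP => U _; apply: sub_hull; exists U.
Qed.

End transfinite.

End operators.

Lemma favorable_pi_regular (R : realType) (X : topologicalType) :
  tychonoff_space X -> I_favorable_cozero R X ->
  every_Cstar_embedding_pi_regular R X.
Proof.
move=> [_ crX] [sigma win] Y i _ iC.
have [wo woS] := well_ordering_principle (nonempty_cozero R X).
have [e [eo et ed ei]] := regular_operator_ex win iC woS.
(* The operator lives on the subtype of co-zero sets; e' is its extension by the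
   empty set to all subsets of X. *)
pose e' (U : set X) :=
  [set y | exists UP : nonempty_cozero R X U, e (SigSub (mem_set UP)) y].
have e'E U (UP : nonempty_cozero R X U) : e' U = e (SigSub (mem_set UP)).
  apply/seteqP; split=> y; last by exists UP.
  by move=> [UP']; rewrite (Prop_irrelevance UP' UP).
exists (nonempty_cozero R X), e'; split=> [|U UP|U UP|U V UP VP UV].
- exact: cozero_pi_base.
- by rewrite (e'E _ UP); exact: eo.
- by rewrite (e'E _ UP); split; [exact: et|exact: (ed (SigSub (mem_set UP)) I)].
- rewrite (e'E _ UP) (e'E _ VP).
  exact: (ei (SigSub (mem_set UP)) (SigSub (mem_set VP)) I I UV).
Qed.

(** * Neighbourhoods in products and in inverse limits *)

Lemma cvg_prod_topology (I : Type) (T : I -> topologicalType)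
    (F : set_system (prod_topology T)) (t : prod_topology T) : Filter F ->
  (forall i (C : set (T i)), open C -> C (t i) -> F [set y | C (y i)]) -> F --> t.
Proof.
move=> FF Fi; apply/cvg_sup => i A [_ [[C oC <-] Ct CA]].
by apply: filterS CA _; exact: Fi.
Qed.

Lemma prod_coordinate_continuous (I : Type) (T : I -> topologicalType) i :
  continuous (fun t : prod_topology T => t i).
Proof.
move=> t C; rewrite nbhsE => -[O [oO Oti] OC].
have /cvg_sup /(_ i) ti : nbhs t --> (t : prod_topology T) by [].
apply: (ti [set y | C (y i)]); rewrite nbhsE.
by exists [set y | O (y i)] => [|y]; [split=> //; exists O|exact: OC].
Qed.

(** Conditions on finitely many coordinates of a point of the limit pull back,
    along the bonding maps, to one condition on the last of them. *)
Lemma nbhs_invlim_seq (T : nat -> topologicalType) (p : forall n, T n.+1 -> T n)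
    (w : invlim_seq p) (O : set (invlim_seq p)) :
  (forall n, continuous (p n)) -> nbhs w O ->
  exists n (G : set (T n)), [/\ open G, G (val w n) &
    forall w' : invlim_seq p, G (val w' n) -> O w'].
Proof.
move=> cp wO.
have lift n m (G : set (T n)) : open G -> G (val w n) -> (n <= m)%N ->
    exists G' : set (T m), [/\ open G', G' (val w m) &
      forall w' : invlim_seq p, G' (val w' m) -> G (val w' n)].
  move=> oG Gw; elim: m => [|m IHm].
    by rewrite leqn0 => /eqP n0; subst n; exists G.
  rewrite leq_eqVlt => /orP[/eqP nm|/IHm[G' [oG' G'w G'G]]].
    by subst n; exists G.
  exists (p m @^-1` G'); split.
  - by apply: open_comp => // t _; exact: cp.
  - by rewrite /= (set_valP w m).
  - by move=> w'; rewrite /= (set_valP w' m); exact: G'G.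
pose F : set_system (prod_topology T) := [set P | exists n (G : set (T n)),
  [/\ open G, G (val w n) & forall w' : invlim_seq p, G (val w' n) -> P (val w')]].
have FF : Filter F.
  split.
  - by exists 0%N, setT; split=> //; exact: openT.
  - move=> P Q [n [G [oG Gw GP]]] [m [H [oH Hw HQ]]].
    have [G' [oG' G'w G'G]] := lift n (maxn n m) G oG Gw (leq_maxl _ _).
    have [H' [oH' H'w H'H]] := lift m (maxn n m) H oH Hw (leq_maxr _ _).
    exists (maxn n m), (G' `&` H'); split=> //; first exact: openI.
    by move=> w' [/G'G/GP Pw' /H'H/HQ Qw'].
  - by move=> P Q PQ [n [G [oG Gw GP]]]; exists n, G; split=> // w' /GP/PQ.
have Fw : F --> (val w : prod_topology T).
  by apply: cvg_prod_topology => n C oC Cw; exists n, C; split.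
have [_ [[C oC <-] Cw CO]] := wO.
have [n [G [oG Gw GC]]] : F C by apply: Fw; exact: open_nbhs_nbhs.
by exists n, G; split=> // w' /GC Cw'; exact: CO.
Qed.

(** Openness of k onto its image is tested on single coordinates, which is
    enough for maps into limits of directed systems. *)
Lemma embedding_in_product (Z : topologicalType) (A : Type)
    (T : A -> topologicalType) (L : set (prod_topology T)) (k : Z -> L) :
  (forall a, continuous (fun z => val (k z) a)) -> injective k ->
  (forall z (O : set Z), open O -> O z -> exists a (G : set (T a)),
     [/\ open G, G (val (k z) a) & forall z', G (val (k z') a) -> O z']) ->
  embedding k.
Proof.
move=> kc kinj kO.
have ck : continuous k.
  apply/continuousP => _ [B oB <-]; rewrite openE => z /= Bz.
  have kz : val (k z') @[z' --> z] --> (val (k z) : prod_topology T).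
    by apply: cvg_prod_topology => a C oC Cz; apply: (kc a z); exact: open_nbhs_nbhs.
  by apply: kz; exact: open_nbhs_nbhs.
have cval a : continuous (fun w : L => val w a).
  move=> w; apply: (@continuous_comp L (prod_topology T) _ val (fun t => t a)).
    exact: initial_continuous.
  exact: prod_coordinate_continuous.
split=> // O oO.
pose V := [set w : L | exists a (G : set (T a)), [/\ open G, G (val w a) &
   forall z', G (val (k z') a) -> O z']].
exists V.
  rewrite openE => w [a [G [oG Gw GO]]].
  apply: filterS (_ : nbhs w [set w' : L | G (val w' a)]).
    by move=> w' Gw'; exists a, G.
  by apply: (cval a w); exact: open_nbhs_nbhs.
apply/seteqP; split=> z /=; last by exact: kO.
by move=> [a [G [_ Gz]]]; exact.
Qed.

(** * Skeletally generated spaces are I-favorable *)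

(** Choose a co-zero set inside each ball of radius 1/(m+1) around a point of a
    dense sequence. *)
Lemma separable_metric_pi_base (R : realType) (T : metricType R) :
  [set: T] !=set0 -> separable T ->
  exists v : nat -> nonempty_cozero R T,
    forall O : set T, open O -> O !=set0 -> exists n, val (v n) `<=` O.
Proof.
move=> [t0 _] [D /pfcard_geP cD dD].
have [d dD'] : exists d : nat -> T, D `<=` range d.
  case: cD => [->|[d]]; first by exists (fun=> t0).
  by exists d => U /'surj_d[n _ <-]; exists n.
have crT : completely_regular_space T by exact: uniform_completely_regular.
have /choice[v vP] (nm : nat * nat) : exists V : nonempty_cozero R T,
    val V `<=` ball (d nm.1) nm.2.+1%:R^-1.
  have [_ /(_ (ball (d nm.1) nm.2.+1%:R^-1)°)] := @cozero_pi_base R T crT.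
  case=> [||V [VS _ Vb]]; first exact: open_interior.
    by exists (d nm.1); apply: nbhsx_ballx; rewrite invr_gt0.
  by exists (SigSub (mem_set VS)); apply: subset_trans Vb _; exact: interior_subset.
exists (fun n => v (odflt (0, 0)%N (unpickle n))) => O oO [t Ot].
have /nbhs_ballP[e /= e0 teO] : nbhs t O by exact: open_nbhs_nbhs.
have e20 : 0 < e / 2 by rewrite divr_gt0.
have [|s [ts Ds]] := dD (ball t (e / 2))° _ (@open_interior _ _).
  by exists t; apply: nbhsx_ballx.
have [n _ dn] := dD' _ Ds.
have [m m2] := exists_invS_lt e20.
exists (pickle (n, m)); rewrite pickleK /= => s' /vP /= vs'.
apply: teO; rewrite (splitr e); apply: ball_triangle (interior_subset ts) _.
by rewrite -dn; apply: le_ball vs'; exact: ltW.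
Qed.

Section generated_favorable.
Context (R : realType) (X : topologicalType) (d : Order.disp_t) (A : porderType d).
Context (T : A -> metricType R) (S : inverse_system T) (j : X -> invlim S).
Hypotheses (X0 : [set: X] !=set0) (crX : completely_regular_space X).
Hypotheses (j_cont : continuous j)
  (j_surj : forall a, range (fun x => val (j x) a) = setT)
  (j_ext : forall f : X -> R, continuous f -> bounded_fun f ->
     exists (a : A) (g : T a -> R),
       continuous g /\ forall x, f x = g (val (j x) a)).

Let p a x := val (j x) a.

Lemma limit_proj_continuous a : continuous (p a).
Proof.
move=> x; apply: (@continuous_comp _ _ _ (fun x => val (j x)) (fun t => t a)).
  by apply: continuous_comp; [exact: j_cont|exact: initial_continuous].
exact: prod_coordinate_continuous.
Qed.

Lemma limit_proj_bond a b (ab : (a <= b)%O) x : bond S ab (p b x) = p a x.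
Proof. exact: set_valP (j x) a b ab. Qed.

Lemma cozero_limit_proj (U : nonempty_cozero R X) (a : A) :
  exists2 b, (a <= b)%O & exists2 W : set (T b), open W & val U = p b @^-1` W.
Proof.
have [cU _] := set_valP U; have [h [ch hb _ _ Uh]] := cozero_capped cU ltr01.
have [b [g [cg hg]]] := j_ext ch hb.
have [c [ac bc]] := index_directed S a b.
exists c => //; exists (bond S bc @^-1` [set t | 0 < g t]).
  apply: open_comp => [t _|]; first exact: bond_continuous.
  by apply: open_lt_continuous => //; exact: cst_continuous.
by rewrite Uh; apply/seteqP; split=> x /=; rewrite limit_proj_bond hg.
Qed.

Hypothesis S_skel : forall a b (ab : (a <= b)%O), skeletal (bond S ab).

(** A co-zero set inside U is pulled back from a stage above a, and the bonding
    map from that stage to a is skeletal. *)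
Lemma limit_proj_skeletal a : skeletal (p a).
Proof.
move=> U oU U0; have [_ /(_ U oU U0)[V [VS _ VU]]] := @cozero_pi_base R X crX.
have [b ab [W oW VW]] := cozero_limit_proj (SigSub (mem_set VS)) a.
have W0 : W !=set0.
  by have [x Vx] := VS.2; exists (p b x); rewrite -[_ (p b x)]/((p b @^-1` W) x) -VW.
have [t] := S_skel ab oW W0.
exists t; apply: interiorS p0; apply: closureS => _ [u Wu <-].
have [x _ xu] : range (p b) u by rewrite j_surj.
exists x; last by rewrite -(limit_proj_bond ab) xu.
have : (p b @^-1` W) x by rewrite /preimage /= xu.
by rewrite -VW; exact: VU.
Qed.

Hypotheses (T_sep : forall a, separable (T a)) (A_complete : sigma_complete A)
  (S_seq : forall (alpha : nat -> A) (b : A)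
     (alphaS : forall n, (alpha n <= alpha n.+1)%O)
     (alphab : forall n, (alpha n <= b)%O),
     supremums (range alpha) b ->
     exists k : T b -> invlim_seq (T := T \o alpha) (fun n => bond S (alphaS n)),
       [/\ embedding k, dense (range k) &
           forall x n, val (k x) n = bond S (alphab n) x]).

Let Sig := nonempty_cozero R X.

Lemma pullback_pi_base a : exists v : nat -> Sig,
  forall O : set (T a), open O -> O !=set0 -> exists n, val (v n) `<=` p a @^-1` O.
Proof.
have [|w wP] := separable_metric_pi_base _ (T_sep a).
  by have [x _] := X0; exists (p a x).
have /choice[v vE] n : exists V : Sig, val V = p a @^-1` val (w n).
  have [[f cf wf] [t wt]] := set_valP (w n).
  suff V : nonempty_cozero R X (p a @^-1` val (w n)).
    by exists (SigSub (mem_set V)).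
  split.
    exists (f \o p a); last by rewrite wf.
    move=> x; apply: continuous_comp; last exact: cf.
    exact: limit_proj_continuous.
  have [x _ xt] : range (p a) t by rewrite j_surj.
  by exists x; rewrite /preimage /= xt.
exists v => O oO O0; have [n wO] := wP O oO O0.
by exists n; rewrite vE => x; exact: wO.
Qed.

(** [idx s] is a stage from which all sets in the history s are pulled back.  At
    round N with N + 1 = 2^n 3^m, Player I plays the m-th member of the pi-base
    of the stage reached at round n; as n <= N, that stage is known by then, and
    every pair (n, m) is served. *)
Lemma generated_favorable : I_favorable_cozero R X.
Proof.
have /choice[v vP] := pullback_pi_base.
have /choice[next nextP] (aU : A * Sig) : exists b, (aU.1 <= b)%O /\
    exists2 W : set (T b), open W & val aU.2 = p b @^-1` W.
  by have [b ab W] := cozero_limit_proj aU.2 aU.1; exists b.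
have [a0 _] : [set: A] !=set0.
  have [|a _] := @j_ext (fun=> 0) (@cst_continuous _ _ _) _; last by exists a.
  exact: bounded_fun0.
pose idx := foldl (fun a U => next (a, U)) a0.
pose sigma (s : seq Sig) :=
  v (idx (take (logn 2 (size s).+1) s)) (logn 3 (size s).+1).
exists sigma => B BP; pose alpha n := idx (mkseq B n).
have alphaSE n : alpha n.+1 = next (alpha n, B n).
  by rewrite /alpha mkseqS /idx foldl_rcons.
have alphaS n : (alpha n <= alpha n.+1)%O.
  by rewrite alphaSE; have [] := nextP (alpha n, B n).
have BW n : exists2 W : set (T (alpha n.+1)), open W & val (B n) = p _ @^-1` W.
  by rewrite alphaSE; have [] := nextP (alpha n, B n).
have alpha_mono m n : (m <= n)%N -> (alpha m <= alpha n)%O.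
  exact: (homo_leq le_refl le_trans).
have [|||b bsup] := A_complete (C := range alpha).
- by exists (alpha 0%N), 0%N.
- exact: sub_countable (card_image_le _ _) (countableP _).
- move=> _ _ [m _ <-] [n _ <-]; have [mn|nm] := leqP m n; [left|right]; apply: alpha_mono => //.
  exact: ltnW.
have alphab n : (alpha n <= b)%O by apply: bsup.1; exists n.
have [k [[ck _ kemb] _ kE]] := S_seq alphaS alphab bsup.
move=> O O0 oO; have [t tG] := limit_proj_skeletal b oO O0.
have [G oG GE] := kemb _ (open_interior (closure (p b @` O))).
have Gkt : G (k t) by rewrite -[G _]/((k @^-1` G) t) GE.
have [|n [H [oH Ht HG]]] := nbhs_invlim_seq _ (open_nbhs_nbhs (conj oG Gkt)).
  by move=> n; exact: bond_continuous.
have [m mH] := vP (alpha n) H oH (ex_intro _ _ Ht).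
pose N := (2 ^ n * 3 ^ m).-1.
have NE : N.+1 = (2 ^ n * 3 ^ m)%N by rewrite prednK// muln_gt0 !expn_gt0.
have log2N : logn 2 N.+1 = n.
  by rewrite NE lognM ?expn_gt0// !lognX !logn_prime//= muln1 muln0 addn0.
have log3N : logn 3 N.+1 = m.
  by rewrite NE lognM ?expn_gt0// !lognX !logn_prime//= muln1 muln0.
have nN : (n <= N)%N.
  rewrite -ltnS NE; apply: leq_trans (ltn_expl n (isT : 1 < 2)%N) _.
  by rewrite leq_pmulr// expn_gt0.
have BN : val (B N) `<=` p (alpha n) @^-1` H.
  apply: subset_trans (BP N) _; rewrite /sigma size_mkseq log2N log3N.
  by rewrite /mkseq -map_take take_iota (minn_idPl nN).
have [x BNx] := nonempty_cozero_neq0 (B N).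
have [W oW BNE] := BW N.
have : closure (p b @` O) (p b x).
  suff : (k @^-1` G) (p b x) by rewrite GE; exact: interior_subset.
  by apply: HG; rewrite kE limit_proj_bond; exact: BN.
have oW' : open (bond S (alphab N.+1) @^-1` W).
  by apply: open_comp => // u _; exact: bond_continuous.
have W'x : (bond S (alphab N.+1) @^-1` W) (p b x).
  by rewrite /preimage /= limit_proj_bond -[W _]/((p _ @^-1` W) x) -BNE.
move=> /(_ _ (open_nbhs_nbhs (conj oW' W'x)))[_ [[o Oo <-]]].
rewrite /preimage /= limit_proj_bond => Wo.
by exists o; split=> //; exists N => //; rewrite BNE.
Qed.
End generated_favorable.

(** * Rational boxes in real powers *)

Section boxes.
Context (R : realType) (I : eqType).
Implicit Types (s : seq (I * (rat * rat))) (a : set I) (y : I -> R).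

(** A box is given by finitely many conditions p < y i < q.  Rational bounds
    leave only countably many boxes on a countable set of coordinates. *)
Definition box s : set (I -> R) :=
  [set y | all (fun c => ratr c.2.1 < y c.1 < ratr c.2.2) s].

Fixpoint supp s : set I := if s is c :: s' then c.1 |` supp s' else set0.

Lemma boxP s y :
  box s y <-> {in s, forall c, ratr c.2.1 < y c.1 < ratr c.2.2}.
Proof. by rewrite /box /mkset; split=> /allP. Qed.

Lemma box_cat s s' : box (s ++ s') = box s `&` box s'.
Proof. by apply/seteqP; split=> y; rewrite /box /= all_cat => /andP. Qed.

Lemma supp_cat s s' : supp (s ++ s') = supp s `|` supp s'.
Proof. by elim: s => [|c s IHs]; rewrite /= ?set0U// IHs setUA. Qed.

Lemma eq_box s y y' : {in supp s, y =1 y'} -> box s y -> box s y'.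
Proof.
elim: s => //= c s IHs yy' /andP[cy sy]; apply/andP; split.
  by rewrite -yy' ?inE//; left.
by apply: IHs sy => i; rewrite inE => si; apply: yy'; rewrite inE; right.
Qed.

Lemma countable_supp s : countable (supp s).
Proof.
elim: s => [|c s IHs] /=; first exact: countable0.
by apply: countable_setU => //; exact: countable1.
Qed.

Lemma supp_sub_bigcup (J : Type) (C : set J) (a : J -> set I) s : C !=set0 ->
  (forall j k, C j -> C k -> exists2 l, C l & a j `|` a k `<=` a l) ->
  supp s `<=` \bigcup_(j in C) a j -> exists2 j, C j & supp s `<=` a j.
Proof.
move=> [j0 Cj0] dir; elim: s => [_|c s IHs] /=; first by exists j0.
rewrite subUset sub1set => -[/set_mem[j Cj jc] /IHs[k Ck sk]].
have [l Cl] := dir j k Cj Ck; rewrite subUset => -[jl kl]; exists l => //.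
by rewrite subUset sub1set inE; split; [exact: jl|exact: subset_trans kl].
Qed.

Lemma countable_boxes a : countable a -> countable [set s | supp s `<=` a].
Proof.
move=> /pfcard_geP[->|[u]].
  apply: (@sub_countable _ _ _ [set [::]]); last exact: countable1.
  by apply: subset_card_le => -[//|c s] /= /(_ c.1); case; left.
pose f := map (fun c : nat * (rat * rat) => (u c.1, c.2)).
apply: (@sub_countable _ _ _ (range f)); last first.
  exact: sub_countable (card_image_le _ _) (countableP _).
apply: subset_card_le; elim=> [_|c s IHs] /=; first by exists [::].
rewrite subUset sub1set inE => -[/'surj_u[n _ un] /IHs[t _ <-]].
by exists ((n, c.2) :: t) => //=; rewrite un -surjective_pairing.
Qed.

Lemma nbhs_rat_itv (r : R) (O : set R) : nbhs r O ->
  exists p q : rat, ratr p < r < ratr q /\ forall v, ratr p < v < ratr q -> O v.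
Proof.
move=> /nbhs_ballP[e /= e0 reO].
have /rat_in_itvoo[p] : r - e < r by rewrite ltrBlDr ltrDl.
have /rat_in_itvoo[q] : r < r + e by rewrite ltrDl.
rewrite !in_itv /= => /andP[rq qe] /andP[ep pr].
exists p, q; split; first by rewrite pr.
move=> v /andP[pv vq]; apply: reO; rewrite /ball /= ltr_norml.
by rewrite ltrBrDl ltrBlDr; apply/andP; split; lra.
Qed.

Lemma nbhs_box (y : prod_topology (fun _ : I => R)) O : nbhs y O ->
  exists2 s, box s y & box s `<=` O.
Proof.
pose F : set_system (prod_topology (fun _ : I => R)) :=
  [set P | exists2 s, box s y & box s `<=` P].
have FF : Filter F.
  split.
  - by exists [::].
  - move=> P Q [s sy sP] [s' s'y s'Q]; exists (s ++ s'); rewrite box_cat //.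
    by apply: setISS.
  - by move=> P Q PQ [s sy sP]; exists s => //; exact: subset_trans PQ.
have Fy : F --> y; last exact: Fy.
apply: cvg_prod_topology => i C oC Cy.
have [p [q [pq pqC]]] := nbhs_rat_itv (open_nbhs_nbhs (conj oC Cy)).
by exists [:: (i, (p, q))] => [|z]; rewrite /box /= andbT //; exact: pqC.
Qed.

Lemma open_box s : open (box s : set (prod_topology (fun _ : I => R))).
Proof.
elim: s => [|c s IHs]; first by have -> : box [::] = setT; [apply/seteqP; split|exact: openT].
rewrite -cat1s box_cat; apply: openI => //.
have cproj : continuous (fun y : prod_topology (fun _ : I => R) => y c.1).
  exact: prod_coordinate_continuous.
have -> : box [:: c] = [set y | ratr c.2.1 < y c.1] `&` [set y | y c.1 < ratr c.2.2].
  by apply/seteqP; split=> y; rewrite /box /= andbT => /andP.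
by apply: openI; apply: open_lt_continuous => //; exact: cst_continuous.
Qed.

Lemma prod_real_tychonoff : tychonoff_space (prod_topology (fun _ : I => R)).
Proof.
split; last exact: uniform_completely_regular.
by apply: hausdorff_product => _; exact: @norm_hausdorff R.
Qed.

End boxes.

(** * Metrizable quotients by countable families of functions *)

Section metric_quotient.
Context (R : realType) (X : Type) (d : X -> X -> R).
Hypotheses (d_refl : forall x, d x x = 0) (d_sym : forall x y, d x y = d y x)
  (d_triangle : forall y x z, d x z <= d x y + d y z).

(** The class of x is encoded by its distance function.  The let keeps the
    axioms of d in the type, so that the metric structure below can be attached
    to it. *)
Definition metric_quotient : Type :=
  let _ := (d_refl, d_sym, d_triangle) in set_type (range d).

HB.instance Definition _ := Choice.on metric_quotient.

Let rep (t : metric_quotient) : X := projT1 (cid2 (set_valP t)).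

Let repE t : d (rep t) = val t.
Proof. by rewrite /rep; case: cid2. Qed.

Definition metric_class (x : X) : metric_quotient :=
  SigSub (mem_set (imageT d x)).

Let quotient_dist (t u : metric_quotient) := d (rep t) (rep u).

Let quotient_distE x y : quotient_dist (metric_class x) (metric_class y) = d x y.
Proof. by rewrite /quotient_dist repE /= d_sym repE /= d_sym. Qed.

Let quotient_dist_refl t : quotient_dist t t = 0.
Proof. exact: d_refl. Qed.

Let quotient_dist_eq0 t u : quotient_dist t u = 0 -> t = u.
Proof.
rewrite /quotient_dist => tu; apply: val_inj; rewrite -!repE.
have d0 x y : d x y = 0 -> forall z, d x z <= d y z.
  by move=> xy z; apply: le_trans (d_triangle y x z) _; rewrite xy add0r.
apply/funext => z; apply/eqP; rewrite eq_le !d0//.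
by rewrite d_sym.
Qed.

Let quotient_dist_sym t u : quotient_dist t u = quotient_dist u t.
Proof. exact: d_sym. Qed.

Let quotient_dist_triangle u t v :
  quotient_dist t v <= quotient_dist t u + quotient_dist u v.
Proof. exact: d_triangle. Qed.

HB.instance Definition _ := @isMetric.Build R metric_quotient quotient_dist
  quotient_dist_refl quotient_dist_eq0 quotient_dist_sym quotient_dist_triangle.

Lemma mdist_class x y :
  @mdist R metric_quotient (metric_class x) (metric_class y) = d x y.
Proof. exact: quotient_distE. Qed.

Lemma metric_class_surj : range metric_class = setT.
Proof.
apply/seteqP; split=> // t _; exists (rep t) => //.
by apply: val_inj; rewrite /= repE.
Qed.

End metric_quotient.

Lemma metric_identification (R : realType) (X : Type) (d : X -> X -> R) :
  (forall x, d x x = 0) -> (forall x y, d x y = d y x) ->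
  (forall y x z, d x z <= d x y + d y z) ->
  exists (T : metricType R) (q : X -> T),
    range q = setT /\ forall x y, mdist (q x) (q y) = d x y.
Proof.
move=> d_refl d_sym d_triangle.
exists (metric_quotient d_refl d_sym d_triangle).
exists (metric_class d_refl d_sym d_triangle).
by split; [exact: metric_class_surj|exact: mdist_class].
Qed.

Lemma min_triangle (R : realDomainType) (t u v w : R) :
  0 <= u -> 0 <= v -> 0 <= w -> t <= u + v ->
  Num.min t w <= Num.min u w + Num.min v w.
Proof.
move=> u0 v0 w0 tuv; rewrite /Num.min.
by case: (ltP t w) => ?; case: (ltP u w) => ?; case: (ltP v w) => ?; lra.
Qed.

Section sup_min_metric.
Context (R : realType) (X : Type) (f : nat -> X -> R).

Let term x y n : R := Num.min `|f n x - f n y| n.+1%:R^-1.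

(** The n-th term of the supremum is at most 1/(n+1), so balls only constrain
    finitely many of the f n: this is the topology of pointwise convergence. *)
Definition sup_min_dist x y := sup (range (term x y)).

Let term_ub x y : has_sup (range (term x y)).
Proof.
split; first by exists (term x y 0%N), 0%N.
exists 1 => _ [n _ <-]; rewrite /term ge_min; apply/orP; right.
by rewrite invf_le1 ?ltr0n// ler1n.
Qed.

Lemma sup_min_dist_ge x y n : Num.min `|f n x - f n y| n.+1%:R^-1 <= sup_min_dist x y.
Proof. by apply: ub_le_sup; [case: (term_ub x y)|exists n]. Qed.

Lemma sup_min_dist_le x y c :
  (forall n, Num.min `|f n x - f n y| n.+1%:R^-1 <= c) -> sup_min_dist x y <= c.
Proof.
move=> h; apply: ge_sup; first by case: (term_ub x y).
by move=> _ [n _ <-]; exact: h.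
Qed.

Lemma sup_min_dist_refl x : sup_min_dist x x = 0.
Proof.
apply/eqP; rewrite eq_le; apply/andP; split.
  by apply: sup_min_dist_le => n; rewrite subrr normr0 ge_min lexx.
apply: le_trans (sup_min_dist_ge x x 0).
by rewrite subrr normr0 le_min lexx invr_ge0 ler0n.
Qed.

Lemma sup_min_dist_sym x y : sup_min_dist x y = sup_min_dist y x.
Proof.
congr sup; suff -> : term x y = term y x by [].
by apply/funext => n; rewrite /term distrC.
Qed.

Lemma sup_min_dist_triangle y x z :
  sup_min_dist x z <= sup_min_dist x y + sup_min_dist y z.
Proof.
apply: sup_min_dist_le => n.
apply: le_trans (lerD (sup_min_dist_ge x y n) (sup_min_dist_ge y z n)).
have n0 : 0 <= n.+1%:R^-1 :> R by rewrite invr_ge0 ler0n.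
exact: min_triangle (normr_ge0 _) (normr_ge0 _) n0 (ler_distD _ _ _).
Qed.

End sup_min_metric.

(** The quotient of X by the pseudometric that the family defines.  No topology
    on X enters: the last two properties say that the quotient has the coarsest
    topology that makes the given functions continuous, expressed by boxes. *)
Lemma countable_family_quotient (R : realType) (I : eqType) (X : Type)
    (F : I -> X -> R) (a : set I) : a !=set0 -> countable a ->
  exists (T : metricType R) (q : X -> T), [/\ range q = setT,
    forall i, a i -> exists2 g : T -> R, continuous g & forall x, g (q x) = F i x &
    forall x W, nbhs (q x) W -> exists s, [/\ supp s `<=` a, box s (F ^~ x) &
      forall x', box s (F ^~ x') -> W (q x')]].
Proof.
move=> [i0 ai0] /pfcard_geP[a0|[u]]; first by rewrite a0 in ai0.
have ua n : a (u n) by exact: funS.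
pose f n := F (u n); pose d := sup_min_dist f.
have d_refl := sup_min_dist_refl f; have d_sym := sup_min_dist_sym f.
have d_tri := sup_min_dist_triangle f.
have [T [q [q_surj qd]]] := metric_identification d_refl d_sym d_tri.
exists T, q; split=> // [i ai|x W /nbhs_ballP[e /= e0 We]].
  have [n _ un] := 'surj_u ai.
  have /choice[rep repE] t : exists x, q x = t.
    by have [x _ xt] : range q t by [rewrite q_surj]; exists x.
  have gE x y r : r <= n.+1%:R^-1 -> d x y < r -> `|F i x - F i y| < r.
    move=> rn /(le_lt_trans (sup_min_dist_ge f x y n)).
    by rewrite /f un gt_min [X in _ || X]ltNge rn orbF.
  (* F i is constant on the fibres of q, whence the choice of representatives does
     not matter. *)
  have gq x : F i (rep (q x)) = F i x.
    apply/eqP; rewrite -subr_eq0 -normr_le0 leNgt; apply/negP => ne0.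
    have d0 : d (rep (q x)) x = 0 by rewrite -[d _ _]qd repE qd d_refl.
    have : d (rep (q x)) x < Num.min `|F i (rep (q x)) - F i x| n.+1%:R^-1.
      by rewrite d0 lt_min ne0 invr_gt0 ltr0n.
    by move=> /gE; rewrite ge_min lexx orbT lt_min ltxx => /(_ isT).
  exists (F i \o rep) => // t; apply/cvgrPdist_lt => e e0.
  have m0 : 0 < Num.min e n.+1%:R^-1 by rewrite lt_min e0 invr_gt0 ltr0n.
  near=> t'; have : d (rep t) (rep t') < Num.min e n.+1%:R^-1.
    rewrite -[d _ _]qd !repE; near: t'; have := nbhsx_ballx t _ m0.
    by rewrite ballEmdist.
  by move=> /gE; rewrite ge_min lexx orbT lt_min => /(_ isT)/andP[].
have e20 : 0 < e / 2 by rewrite divr_gt0.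
have [M Me] := exists_invS_lt e20.
have /choice[c cP] n : exists c : rat * rat, ratr c.1 < f n x < ratr c.2 /\
    forall v, ratr c.1 < v < ratr c.2 -> `|f n x - v| < e / 2.
  have [p [p' [pp' h]]] := nbhs_rat_itv (nbhsx_ballx (f n x) _ e20).
  by exists (p, p').
pose s := [seq (u n, c n) | n <- iota 0 M.+1].
have sE y : box s (F ^~ y) <-> forall n, (n <= M)%N -> ratr (c n).1 < f n y < ratr (c n).2.
  rewrite /box /mkset /s all_map; split=> [ys n nM|h].
    by apply: (allP ys n); rewrite mem_iota.
  by apply/allP => n; rewrite mem_iota /= add0n ltnS; exact: h.
exists s; split.
- by rewrite /s; elim: (iota _ _) => //= n t IHt i [->|/IHt//].
- by apply/sE => n _; have [] := cP n.
move=> y /sE sy; apply: We; rewrite ballEmdist /= qd.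
apply: le_lt_trans (_ : e / 2 < e); last by rewrite ltr_pdivrMr// ltr_pMr// ltr1n.
apply: sup_min_dist_le => n; rewrite ge_min; have [nM|Mn] := leqP n M.
  by rewrite ltW//; have [_ ->] := cP n; rewrite // sy.
apply/orP; right; apply: le_trans (ltW Me).
by rewrite lef_pV2 ?posrE ?ltr0n// ler_nat ltnS ltnW.
Unshelve. all: by end_near.
Qed.

(** * From pi-regularity to skeletal quotients *)

Section evaluation.
Context (R : realType) (X : topologicalType) (I : eqType) (F : I -> X -> R).

Definition evaluation (x : X) : prod_topology (fun _ : I => R) := fun i => F i x.

Local Notation ev := evaluation.

Lemma evaluation_continuous : (forall i, continuous (F i)) -> continuous ev.
Proof.
move=> cF x; apply: cvg_prod_topology => i C oC Cx.
by apply: (cF i x); exact: open_nbhs_nbhs.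
Qed.

(** The quotient map of X by the functions indexed by a is skeletal: the closure
    of the image of W contains the image of the box s.  Stated with boxes on a,
    which stand for the open sets of the quotient. *)
Definition box_reflecting (a : set I) :=
  forall W : set X, open W -> W !=set0 -> exists s, [/\ supp s `<=` a,
    exists x, box s (ev x) &
    forall s', supp s' `<=` a -> (exists x, box s (ev x) /\ box s' (ev x)) ->
      exists x, W x /\ box s' (ev x)].

(** For a box s meeting X, [h s] is a box meeting X inside e(V), for some V of the
    pi-base inside s.  Given W, take U in W from the pi-base and a box s inside
    e(U); the box s0 of those conditions of s that bear on a reflects W.  Indeed, if
    a smaller box s' on a missed W, the set V obtained from s' and s0 would be
    disjoint from U, while the box in e(V) lives on a and is compatible with s0,
    hence meets s in a point whose coordinates outside a are taken from s. *)
Lemma pi_regular_box_reflecting : (forall i, continuous (F i)) -> pi_regular ev ->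
  exists h : seq (I * (rat * rat)) -> seq (I * (rat * rat)),
    forall a, (forall s, supp s `<=` a -> supp (h s) `<=` a) -> box_reflecting a.
Proof.
move=> cF [B [e [[Bo Bbase] eo etd ed]]].
have cev := evaluation_continuous cF.
have in_e U : B U -> U !=set0 -> exists s x, box s (ev x) /\ box s `<=` e U.
  move=> BU [x Ux]; have [_ Ud] := etd U BU.
  have [y [/= ey _]] := Ud x Ux U (open_nbhs_nbhs (conj (Bo U BU) Ux)).
  have [s sy se] := nbhs_box (open_nbhs_nbhs (conj (eo U BU) ey)).
  by exists s, y.
have step s : exists s', (exists x, box s (ev x)) -> exists U x,
    [/\ B U, U `<=` ev @^-1` box s, box s' `<=` e U & box s' (ev x)].
  have [[x sx]|] := pselect (exists x, box s (ev x)); last by exists s.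
  have [||U [BU U0 Us]] := Bbase (ev @^-1` box s).
  - by apply: open_comp => [y _|]; [exact: cev|exact: open_box].
  - by exists x.
  have [s' [y [s'y s'e]]] := in_e U BU U0.
  by exists s' => _; exists U, y.
have [h hP] := choice step; exists h => a ha W oW W0.
have [U [BU U0 UW]] := Bbase W oW W0.
have [s [x0 [sx0 se]]] := in_e U BU U0.
pose s0 := [seq c <- s | c.1 \in a].
have s0a : supp s0 `<=` a.
  rewrite /s0; elim: (s) => //= c t IHt; case: ifPn => // /set_mem ca.
  by move=> i [->|/IHt].
have s0s : @box R I s `<=` box s0.
  by move=> y /boxP ys; apply/boxP => c; rewrite mem_filter => /andP[_ /ys].
exists s0; split=> //; first by exists x0; exact: s0s.
move=> s' s'a [x1 [s0x1 s'x1]].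
have [|V [x [BV Vss' hV hx]]] := hP (s' ++ s0).
  by exists x1; rewrite box_cat.
have Vx : (ev @^-1` box (s' ++ s0)) x.
  by apply: Vss'; have [+ _] := etd V BV; apply; exact: hV.
apply: contrapT => noW.
have UV : U `&` V = set0.
  rewrite -subset0 => y [Uy Vy]; apply: noW; exists y; split; first exact: UW.
  by have := Vss' y Vy; rewrite /= box_cat => -[].
(* x satisfies the conditions on a, and x0 those of s outside a. *)
pose y : prod_topology (fun _ : I => R) := fun i => if i \in a then ev x i else ev x0 i.
suff : (e U `&` e V) y by rewrite ed.
split.
  apply: se; apply/boxP => c cs; rewrite /y.
  case: ifPn => ca; last by move/boxP : sx0; exact.
  move: Vx; rewrite /= box_cat => -[_ /boxP]; apply.
  by rewrite mem_filter ca.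
apply: hV; apply: eq_box hx => i; rewrite inE => hi; rewrite /y ifT// inE.
by apply: ha hi; rewrite supp_cat subUset.
Qed.

End evaluation.

(** * The inverse system of metrizable quotients *)

Section subset_order.
Context (I : Type) (P : set (set I)).

Definition subsets_in : Type := set_type P.

HB.instance Definition _ := Choice.on subsets_in.

Let le (a b : subsets_in) := `[< val a `<=` val b >].

Let le_refl : reflexive le.
Proof. by move=> a; apply/asboolP. Qed.

Let le_anti : antisymmetric le.
Proof.
move=> a b /andP[/asboolP ab /asboolP ba].
by apply: val_inj; apply/seteqP.
Qed.

Let le_trans : transitive le.
Proof. by move=> b a c /asboolP ab /asboolP bc; apply/asboolP; exact: subset_trans bc. Qed.

HB.instance Definition _ := @Order.Le_isPOrder.Build (Order.Disp tt tt) subsets_in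
  le le_refl le_anti le_trans.

Lemma subsets_inP (a b : subsets_in) : (a <= b)%O <-> val a `<=` val b.
Proof. by split=> [/asboolP|?]; last exact/asboolP. Qed.

End subset_order.

Section system_of_quotients.
Context (R : realType) (X : topologicalType) (I : eqType) (F : I -> X -> R).
Local Notation ev := (evaluation F).
Context (good : set (set I)).
Local Notation A := (subsets_in good).
Context (T : A -> metricType R) (q : forall a, X -> T a).
Hypotheses (F_cont : forall i, continuous (F i))
  (q_surj : forall a, range (q a) = setT)
  (q_factor : forall (a : A) i, val a i ->
     exists2 g : T a -> R, continuous g & forall x, g (q a x) = F i x)
  (q_box : forall (a : A) x W, nbhs (q a x) W -> exists s,
     [/\ supp s `<=` val a, box s (ev x) & forall x', box s (ev x') -> W (q a x')]).

Lemma nbhs_quotient_box (a : A) s x : supp s `<=` val a -> box s (ev x) ->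
  nbhs (q a x) [set t | forall x', q a x' = t -> box s (ev x')].
Proof.
elim: s => [_ _|c s IHs] /=; first exact: filterE.
rewrite subUset sub1set => -[/set_mem ca sa] /andP[/andP[lx xu] sx].
have [g cg gq] := q_factor ca.
have gx : nbhs (q a x) ([set t | ratr c.2.1 < g t] `&` [set t | g t < ratr c.2.2]).
  apply: open_nbhs_nbhs; split; last by rewrite /= gq.
  by apply: openI; apply: open_lt_continuous => //; exact: cst_continuous.
apply: filterS (filterI gx (IHs sa sx)) => t [[gl gu] st] x' x't.
apply/boxP => c'; rewrite inE => /predU1P[->|].
  by move: gl gu; rewrite /= -x't gq => -> ->.
by move/boxP : (st x' x't); exact.
Qed.

Lemma box_nbhs_quotient (a : A) s x (W : set (T a)) : supp s `<=` val a -> box s (ev x) ->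
  (forall x', box s (ev x') -> W (q a x')) -> nbhs (q a x) W.
Proof.
move=> sa sx sW; apply: filterS (nbhs_quotient_box sa sx) => t h.
have [x' _ x't] : range (q a) t by rewrite q_surj.
by rewrite -x't; apply: sW; exact: h.
Qed.

Lemma quotient_continuous (a : A) : continuous (q a).
Proof.
move=> x W /q_box[s [_ sx sW]].
apply: filterS (_ : nbhs x (ev @^-1` box s)); first exact: sW.
by apply: (evaluation_continuous F_cont); apply: open_nbhs_nbhs; split=> //; exact: open_box.
Qed.

Lemma quotient_eqP (a : A) x y : q a x = q a y <-> {in val a, forall i, F i x = F i y}.
Proof.
split=> [qxy i|Fxy].
  by rewrite inE => /q_factor[g _ gq]; rewrite -!gq qxy.
apply: (@metric_hausdorff _ (T a)) => U V /q_box[s [sa sx sU]] qyV.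
exists (q a y); split; last exact: nbhs_singleton.
apply: sU; apply: eq_box sx => i; rewrite inE => /sa ai; apply: Fxy.
by rewrite inE.
Qed.

Let rep (a : A) (t : T a) : exists x, q a x = t.
Proof. by have [x _ xt] : range (q a) t by [rewrite q_surj]; exists x. Qed.

(** The choice of a representative is immaterial, by [quotient_bondE]: points
    identified by the functions in b are identified by those in a. *)
Definition quotient_bond (a b : A) (_ : (a <= b)%O) (t : T b) : T a :=
  q a (projT1 (cid (rep t))).

Lemma quotient_bondE (a b : A) (ab : (a <= b)%O) x : quotient_bond ab (q b x) = q a x.
Proof.
rewrite /quotient_bond; case: cid => y /= /quotient_eqP Fyx.
apply/quotient_eqP => i; rewrite inE => ai; apply: Fyx; rewrite inE.
by move/subsets_inP : ab; exact.
Qed.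

Let quotient_ind (a : A) (P : T a -> Prop) : (forall x, P (q a x)) -> forall t, P t.
Proof. by move=> Pq t; have [x <-] := rep t. Qed.

Hypothesis A_directed : forall a b : A, exists c : A, (a <= c)%O /\ (b <= c)%O.

Definition quotient_system : inverse_system T.
Proof.
apply: (@InverseSystem _ _ _ quotient_bond) => //.
- move=> a b ab; apply: quotient_ind => x W; rewrite quotient_bondE => /q_box[s [sa sx sW]].
  apply: (box_nbhs_quotient (s := s)) => // [|x' /sW].
    by apply: subset_trans sa _; exact/subsets_inP.
  by rewrite /preimage /= quotient_bondE.
- move=> a b ab; apply/seteqP; split=> //; apply: quotient_ind => x _.
  by exists (q b x) => //; exact: quotient_bondE.
- by move=> a aa; apply: quotient_ind => x; rewrite quotient_bondE.
- by move=> a b c ab bc ac; apply: quotient_ind => x; rewrite !quotient_bondE.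
Defined.

Local Notation S := quotient_system.

Lemma quotient_systemE (a b : A) (ab : (a <= b)%O) x : bond S ab (q b x) = q a x.
Proof. exact: quotient_bondE. Qed.

Lemma quotient_system_skeletal (a b : A) (ab : (a <= b)%O) :
  box_reflecting F (val a) -> skeletal (bond S ab).
Proof.
move=> refl U oU [t Ut]; pose W := q b @^-1` U.
have oW : open W by apply: open_comp => // x _; exact: quotient_continuous.
have W0 : W !=set0 by have [x xt] := rep t; exists x; rewrite /W /preimage /= xt.
have [s [sa [x sx] sW]] := refl W oW W0.
exists (q a x); apply: (box_nbhs_quotient sa sx) => x' sx' N /q_box[s' [s'a s'x' s'N]].
have [|y [Wy s'y]] := sW s' s'a; first by exists x'.
by exists (q a y); split; [exists (q b y); rewrite ?quotient_systemE|exact: s'N].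
Qed.

Lemma quotient_separable (a : A) : [set: X] !=set0 -> countable (val a) -> separable (T a).
Proof.
move=> [x0 _] ca.
have /choice[f fP] s : exists x, (exists x, box s (ev x)) -> box s (ev x).
  by have [[x sx]|] := pselect (exists x, box s (ev x)); [exists x|exists x0].
exists [set q a (f s) | s in [set s | supp s `<=` val a]].
  exact: sub_countable (card_image_le _ _) (countable_boxes ca).
move=> O + oO; case; apply: quotient_ind => x Ox.
have [s [sa sx sO]] := q_box (open_nbhs_nbhs (conj oO Ox)).
by exists (q a (f s)); split; [apply: sO; apply: fP; exists x|exists s].
Qed.

(** A box has finite support, so a box on the union of the sets alpha n is a box
    on one of them. *)
Lemma quotient_limit_embedding (alpha : nat -> A) (b : A)
    (alphaS : forall n, (alpha n <= alpha n.+1)%O)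
    (alphab : forall n, (alpha n <= b)%O) :
  val b `<=` \bigcup_n val (alpha n) ->
  exists k : T b -> invlim_seq (T := T \o alpha) (fun n => bond S (alphaS n)),
    [/\ embedding k, dense (range k) &
        forall x n, val (k x) n = bond S (alphab n) x].
Proof.
move=> bU.
have kP t : (fun n => bond S (alphab n) t) \in
    invlim_seq (T := T \o alpha) (fun n => bond S (alphaS n)).
  by apply/mem_set => n; exact: (bond_trans S).
pose k t : invlim_seq (T := T \o alpha) (fun n => bond S (alphaS n)) :=
  SigSub (kP t).
have kE t n : val (k t) n = bond S (alphab n) t by [].
have alpha_mono m n : (m <= n)%N -> val (alpha m) `<=` val (alpha n).
  move=> mn; apply/subsets_inP; move: mn.
  exact: (homo_leq (@Order.POrderTheory.le_refl _ _) (@Order.POrderTheory.le_trans _ _)).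
exists k; split=> //.
- apply: embedding_in_product.
  + by move=> n; apply: bond_continuous.
  + apply: quotient_ind => x; apply: quotient_ind => y kxy.
    apply/quotient_eqP => i; rewrite inE => /bU[n _ ni].
    have : q (alpha n) x = q (alpha n) y.
      by rewrite -!(quotient_systemE (alphab n)) -!kE kxy.
    by move/quotient_eqP; apply; rewrite inE.
  + apply: quotient_ind => x O oO Ox.
    have [s [sb sx sO]] := q_box (open_nbhs_nbhs (conj oO Ox)).
    have [|m n _ _|n _ sn] := supp_sub_bigcup _ _ (subset_trans sb bU).
    * by exists 0%N.
    * exists (maxn m n) => //.
      by rewrite subUset; split; apply: alpha_mono; rewrite ?leq_maxl ?leq_maxr.
    exists n, [set t | forall x', q (alpha n) x' = t -> box s (ev x')]°; split.
    * exact: open_interior.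
    * by rewrite kE quotient_systemE; exact: nbhs_quotient_box.
    * apply: quotient_ind => y; rewrite kE quotient_systemE => /interior_subset.
      by move=> /(_ y erefl); exact: sO.
- move=> O [w Ow] oO.
  have [|n [G [oG Gw GO]]] := nbhs_invlim_seq _ (open_nbhs_nbhs (conj oO Ow)).
    by move=> n; exact: bond_continuous.
  have [x xw] := rep (val w n).
  exists (k (q b x)); split; last by exists (q b x).
  by apply: GO; rewrite kE quotient_systemE xw.
Qed.

Hypothesis A_cofinal : forall c : set I, countable c -> exists a : A, c `<=` val a.

Lemma quotient_space_embedding :
  (forall x y, (forall i, F i x = F i y) -> x = y) ->
  (forall x (O : set X), open O -> O x ->
     exists2 s, box s (ev x) & forall x', box s (ev x') -> O x') ->
  exists j : X -> invlim S, embedding j /\ forall x a, val (j x) a = q a x.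
Proof.
move=> F_inj F_base.
have jP x : (fun a => q a x) \in invlim S.
  by apply/mem_set => a b ab; exact: quotient_systemE.
pose j x : invlim S := SigSub (jP x).
have jE x a : val (j x) a = q a x by [].
exists j; split=> //; apply: embedding_in_product.
- by move=> a; exact: quotient_continuous.
- move=> x y jxy; apply: F_inj => i.
  have [a ia] := A_cofinal (countable1 i).
  have : q a x = q a y by rewrite -!jE jxy.
  by move/quotient_eqP; apply; rewrite inE; exact: ia.
- move=> x O oO Ox; have [s sx sO] := F_base x O oO Ox.
  have [a sa] := A_cofinal (countable_supp s).
  exists a, [set t | forall x', q a x' = t -> box s (ev x')]°; split.
  + exact: open_interior.
  + exact: nbhs_quotient_box.
  + by move=> y /interior_subset /(_ y erefl); exact: sO.
Qed.

End system_of_quotients.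

(** * Countable index sets closed under an operation on boxes *)

Section closed_index_sets.
Context (R : realType) (I : eqType).
Context (h : seq (I * (rat * rat)) -> seq (I * (rat * rat))).

Definition closed_index_set : set (set I) := [set a | [/\ a !=set0, countable a &
  forall s, supp s `<=` a -> supp (h s) `<=` a]].

Lemma closed_index_set_bigcup (C : set (set I)) : C !=set0 -> countable C ->
  total_on C subset -> C `<=` closed_index_set ->
  closed_index_set (\bigcup_(a in C) a).
Proof.
move=> [c Cc] cC Ctot Ccl; split.
- by have [[i ci] _ _] := Ccl c Cc; exists i, c.
- by apply: bigcup_countable => // a /Ccl[].
move=> s sC; have [|a b Ca Cb|a Ca sa] := supp_sub_bigcup _ _ sC.
- by exists c.
- by have [ab|ba] := Ctot a b Ca Cb; [exists b|exists a] => //; rewrite subUset; split.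
have [_ _ /(_ s sa) hsa] := Ccl a Ca.
by move=> i /hsa; exists a.
Qed.

(** Iterate the addition of the supports of the [h s]; there are countably many
    boxes s on a countable set. *)
Lemma closed_index_set_cofinal (i0 : I) (c : set I) : countable c ->
  exists2 a, closed_index_set a & c `<=` a.
Proof.
move=> cc; pose grow (a : set I) := a `|` \bigcup_(s in [set s | supp s `<=` a]) supp (h s).
pose fix a n := if n is n'.+1 then grow (a n') else c `|` [set i0].
have ca n : countable (a n).
  elim: n => [|n IHn] /=.
    by apply: countable_setU => //; exact: countable1.
  apply: countable_setU => //.
  by apply: bigcup_countable => [|s _]; [exact: countable_boxes|exact: countable_supp].
have aS m n : (m <= n)%N -> a m `<=` a n.
  apply: (@homo_leq _ a subset) => [x //|y x z xy yz|k]; first exact: subset_trans yz.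
  by move=> i ai; left.
exists (\bigcup_n a n); last by move=> i ci; exists 0%N => //; left.
split.
- by exists i0, 0%N => //; right.
- by apply: bigcup_countable => // n _; exact: ca.
move=> s sa; have [|m n _ _|n _ sn] := supp_sub_bigcup _ _ sa.
- by exists 0%N.
- exists (maxn m n) => //.
  by rewrite subUset; split; apply: aS; rewrite ?leq_maxl ?leq_maxr.
by move=> i hi; exists n.+1 => //; right; exists s.
Qed.

End closed_index_sets.

(** * Spaces with pi-regular C*-embeddings are skeletally generated *)

Section pi_regular_generated.
Context (R : realType) (X : topologicalType).

Definition bounded_map := {classic {f : X -> R | continuous f /\ bounded_fun f}}.

Definition bounded_map_fun (f : bounded_map) : X -> R := proj1_sig f.

Local Notation ev := (evaluation bounded_map_fun).

Lemma bounded_map_continuous f : continuous (bounded_map_fun f).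
Proof. by case: (proj2_sig f). Qed.

Lemma bounded_map_box : completely_regular_space X -> forall x (O : set X),
  open O -> O x -> exists2 s, box s (ev x) & forall x', box s (ev x') -> O x'.
Proof.
move=> crX x O oO Ox.
have [f [cf bf fx0 fO]] := completely_regular_bump R crX oO Ox.
have fx : nbhs (f x) [set r | r < 1].
  by apply: open_nbhs_nbhs; split; [exact: open_lt|rewrite /= fx0].
have [p [p' [pp' h]]] := nbhs_rat_itv fx.
pose i : bounded_map := exist _ f (conj cf bf).
exists [:: (i, (p, p'))] => [|y]; rewrite /box /= andbT // => /h fy1.
by apply: fO; rewrite lt_eqF.
Qed.

Lemma bounded_map_inj : tychonoff_space X ->
  forall x y, (forall f, bounded_map_fun f x = bounded_map_fun f y) -> x = y.
Proof.
move=> [hX crX] x y xy; apply: hX => U V.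
rewrite nbhsE => -[O [oO Ox] OU] yV; exists y; split; last exact: nbhs_singleton.
have [s sx sO] := bounded_map_box crX oO Ox.
by apply/OU/sO; apply: eq_box sx => i _; exact: xy.
Qed.

(** A bounded continuous function extends by the projection that it indexes. *)
Lemma evaluation_Cstar : tychonoff_space X -> Cstar_embedding R ev.
Proof.
move=> tyX; split; last first.
  move=> f cf bf; pose i : bounded_map := exist _ f (conj cf bf).
  by exists (fun y => y i) => //; exact: prod_coordinate_continuous.
split.
- by apply: evaluation_continuous; exact: bounded_map_continuous.
- move=> x y xy; apply: bounded_map_inj => // f.
  by rewrite -[LHS]/(ev x f) xy.
move=> O oO.
exists (\bigcup_(s in [set s | forall x, box s (ev x) -> O x]) box s).
  by apply: bigcup_open => s _; exact: open_box.
apply/seteqP; split=> [x [s sO]|x Ox]; first exact: sO.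
by have [s sx sO] := bounded_map_box tyX.2 oO Ox; exists s.
Qed.

Lemma pi_regular_generated : [set: X] !=set0 -> tychonoff_space X ->
  every_Cstar_embedding_pi_regular R X -> skeletally_generated R X.
Proof.
move=> X0 tyX reg.
have [h hP] := pi_regular_box_reflecting bounded_map_continuous
  (reg _ _ (prod_real_tychonoff _ _) (evaluation_Cstar tyX)).
pose A := subsets_in (closed_index_set h).
have A_val (a : A) : closed_index_set h (val a) by exact: set_valP.
have /choice[T TP] (a : A) := countable_family_quotient bounded_map_fun
  (let: And3 a0 _ _ := A_val a in a0) (let: And3 _ ca _ := A_val a in ca).
pose q a := projT1 (cid (TP a)).
have qP a := projT2 (cid (TP a)).
have q_surj a : range (q a) = setT by have [] := qP a.
have q_factor (a : A) i : val a i ->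
    exists2 g : T a -> R, continuous g & forall x, g (q a x) = bounded_map_fun i x.
  by have [_ + _] := qP a; apply.
have q_box (a : A) x (W : set (T a)) : nbhs (q a x) W -> exists s,
    [/\ supp s `<=` val a, box s (ev x) & forall x', box s (ev x') -> W (q a x')].
  by have [_ _] := qP a; apply.
have i0 : bounded_map.
  by exists (fun=> 0); split; [exact: cst_continuous|exact: bounded_fun0].
have A_cofinal c : countable c -> exists a : A, c `<=` val a.
  by move=> /(closed_index_set_cofinal h i0)[a ha ca]; exists (SigSub (mem_set ha)).
have A_directed (a b : A) : exists c : A, (a <= c)%O /\ (b <= c)%O.
  have [|c] := A_cofinal (val a `|` val b).
    by have [_ ca _] := A_val a; have [_ cb _] := A_val b; exact: (countable_setU ca cb).
  by rewrite subUset => -[/subsets_inP ac /subsets_inP bc]; exists c.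
have A_sup (C : set A) : C !=set0 -> countable C ->
    total_on C (fun a b => (a <= b)%O) ->
    exists2 b : A, supremums C b & val b = \bigcup_(a in C) val a.
  move=> [c Cc] cC Ctot.
  have hC : closed_index_set h (\bigcup_(a in C) val a).
    rewrite -(bigcup_image _ val id); apply: closed_index_set_bigcup.
    - by exists (val c), c.
    - exact: sub_countable (card_image_le _ _) cC.
    - move=> _ _ [a Ca <-] [b Cb <-].
      by have [/subsets_inP ab|/subsets_inP ba] := Ctot a b Ca Cb; [left|right].
    - by move=> _ [a Ca <-]; exact: A_val.
  exists (SigSub (mem_set hC)) => //; split=> [a Ca|b bub].
    by apply/subsets_inP; exact: bigcup_sup.
  by apply/subsets_inP; apply: bigcup_sub => a Ca; apply/subsets_inP; exact: bub.
pose S := quotient_system q_surj q_factor q_box A_directed.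
exists (Order.Disp tt tt), A, T, S.
have [j [j_emb jE]] := quotient_space_embedding bounded_map_continuous q_surj q_factor
  q_box A_directed A_cofinal (bounded_map_inj tyX) (bounded_map_box tyX.2).
split.
- move=> a; have [_ ca _] := A_val a.
  exact: (quotient_separable q_surj q_box X0 ca).
- move=> a b ab; have [_ _ ha] := A_val a.
  by apply: quotient_system_skeletal => //; [exact: bounded_map_continuous|exact: hP].
- by move=> C C0 cC Ctot; have [b bC _] := A_sup C C0 cC Ctot; exists b.
- move=> alpha b alphaS alphab bsup; apply: quotient_limit_embedding.
  have [|||b' b'sup b'E] := A_sup (range alpha).
  - by exists (alpha 0%N), 0%N.
  - exact: sub_countable (card_image_le _ _) (countableP _).
  - move=> _ _ [m _ <-] [n _ <-].
    have homo : {homo alpha : m n / (m <= n)%N >-> (m <= n)%O}.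
      by apply: (homo_leq _ _ alphaS) => [x|y x z]; [exact: lexx|exact: le_trans].
    by have [mn|/ltnW nm] := leqP m n; [left|right]; exact: homo.
  have /subsets_inP : (b <= b')%O by apply: bsup.2; exact: b'sup.1.
  by rewrite b'E bigcup_image.
- exists j; split=> //.
  + move=> a; rewrite -[RHS](q_surj a); congr (_ @` _).
    by apply/funext => x; exact: jE.
  + move=> f cf bf; pose i : bounded_map := exist _ f (conj cf bf).
    have [a ia] := A_cofinal _ (countable1 i).
    have [g cg gq] := q_factor a i (ia i erefl).
    by exists a, g; split=> // x; rewrite jE gq.
Qed.

End pi_regular_generated.

Theorem theorem1p1 (R : realType) (X : topologicalType)
  (X_nonempty : [set: X] !=set0) (X_tychonoff : tychonoff_space X) :
  [<-> I_favorable_cozero R X;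
       every_Cstar_embedding_pi_regular R X;
       skeletally_generated R X].
Proof.
tfae.
- exact: favorable_pi_regular.
- exact: pi_regular_generated.
- move=> [d [A [T [S [T_sep S_skel A_complete S_seq [j [[j_cont _ _] j_surj j_ext]]]]]]].
  exact: (generated_favorable X_nonempty X_tychonoff.2 j_cont j_surj j_ext).
Qed.
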